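(* Let $g\in\mathbb{F}_q[T]$ be monic with $\deg(g)\ge1$ and let $c\in\mathbb{F}_q[T]$ with $(c,g)=1$. Then, for all $u\in\mathbb{C}$ (as an identity of meromorphic functions of $u$), $$\mathcal{D}_2\Big(u;\frac cg\Big)=(qu^2)^{\deg(g)-1}\sum_{\lambda\in\mathbb{F}_q^\times}\mathcal{A}_\lambda(u)\,\mathcal{D}_2\Big(\frac{1}{qu};\frac{\lambda\overline{c}}{g}\Big),$$ where $\overline c$ is any inverse of $c$ modulo $g$ and $$\mathcal{A}_\lambda(u):=\sum_{\eta_1,\eta_2\in\{0,1\}}(-1)^{\eta_1+\eta_2}\frac{\mathrm{Kl}_2\big(\eta_1-1,(1-\eta_2)\lambda\big)}{q(1-qu)^{\eta_1+\eta_2}}=\frac{\mathrm{Kl}_2(-1,\lambda)}{q}+\frac{1+q-2qu}{q(1-qu)^2}.$$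
   Context: $q=p^\eta$ is a prime power; $e_q(y)=\exp(2\pi i\,\mathrm{Tr}_{\mathbb{F}_q/\mathbb{F}_p}(y)/p)$ for $y\in\mathbb{F}_q$; for $\alpha=\sum_{j\le N}\alpha_jT^j\in\mathbb{F}_q((1/T))$, $e(\alpha)=e_q(\alpha_{-1})$. For $\alpha,\beta\in\mathbb{F}_q$, $\mathrm{Kl}_2(\alpha,\beta)=\sum_{\gamma\in\mathbb{F}_q^\times}e_q(\alpha\gamma+\beta\gamma^{-1})$. Let $\mathcal{M}$ be the set of monic polynomials in $\mathbb{F}_q[T]$ and $d(f)$ the number of monic divisors of $f$. For $|u|<1/q$ the Estermann function is $$\mathcal{D}_2(u;c/g)=\sum_{f\in\mathcal{M}}d(f)\,e(cf/g)\,u^{\deg f},$$ extended by meromorphic continuation to all $u\in\mathbb{C}$. *)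

(* Defs.v *)
From mathcomp Require Import all_boot all_order all_algebra all_field.
From mathcomp Require Import complex.
From mathcomp Require Import finmap.
From mathcomp Require Import all_classical all_reals all_analysis.
From mathcomp.analysis.showcase Require Import summability.
From mathcomp Require Import zify.

Set Implicit Arguments.
Unset Strict Implicit.
Unset Printing Implicit Defensive.

Import Order.TTheory GRing.Theory Num.Theory.
Import numFieldNormedType.Exports.

Local Open Scope classical_set_scope.
Local Open Scope ring_scope.

Section Laurent.

Variable F : fieldType.

(* The field F((1/T)): only finitely many coefficients of positive powers of T
   are nonzero. *)
Record laurent := Laurent {
  lcoef :> int -> F;
  _ : exists N : int, forall j, N < j -> lcoef j = 0
}.

(* Expansion of a / g in F((1/T)): the coefficient of T^(-k) is the constant
   coefficient of the polynomial part of T^k a / g; lfracP below checks that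
   this is the quotient. *)
Definition lfrac_coef (a g : {poly F}) (j : int) : F :=
  match j with
  | Posz n => (a %/ g)`_n
  | Negz n => ((a * 'X^(n.+1)) %/ g)`_0
  end.

Fact lfrac_bounded (a g : {poly F}) :
  exists N : int, forall j, N < j -> lfrac_coef a g j = 0.
Proof.
exists (size (a %/ g)); case=> n //=; rewrite ltz_nat => h.
by rewrite nth_default // ltnW.
Qed.

Definition lfrac (a g : {poly F}) : laurent := Laurent (lfrac_bounded a g).

Lemma coef_divp_shift (a g : {poly F}) (M k : nat) : g != 0 ->
  ((a * 'X^M) %/ g)`_(k + M) = (a %/ g)`_k.
Proof.
move=> g0; rewrite {1}(divp_eq a g) mulrDl -mulrA (mulrC g) mulrA.
rewrite divpD mulpK // coefD coefMXn ltnNge leq_addl /= addnK.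
rewrite [X in _ + X]nth_default ?addr0 // size_divp //.
have := ltn_modp a g; rewrite g0 => rg.
have [->|r0] := eqVneq (a %% g) 0; first by rewrite mul0r size_poly0.
rewrite size_Mmonic ?monicXn // size_polyXn.
by move: rg; move: (size (a %% g)) (size g) => r s; lia.
Qed.

Lemma lfrac_shift (a g : {poly F}) (N : nat) (j : int) (k : nat) : g != 0 ->
  j + N%:Z = k%:Z -> lfrac_coef a g j = ((a * 'X^N) %/ g)`_k.
Proof.
move=> g0; case: j => n /= jN.
  have -> : k = (n + N)%N by lia.
  by rewrite coef_divp_shift.
have -> : N = (n.+1 + k)%N by lia.
by rewrite exprD mulrA -[X in _ = _`_X]add0n coef_divp_shift.
Qed.

Lemma lfracP (a g : {poly F}) (n : int) : g != 0 ->
  \sum_(i < size g) g`_i * lfrac a g (n - i%:Z)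
    = if n is Posz k then a`_k else 0.
Proof.
move=> g0; have [N NE] : {N | N = (`|n| + size g)%N} by exists (`|n| + size g)%N.
have [m mE] : exists m : nat, n + N%:Z = m%:Z by exists `|(n + N%:Z)%R|%N; lia.
have sg : (0 < size g)%N by rewrite size_poly_gt0.
have sgm : (size g <= m)%N by lia.
transitivity ((g * ((a * 'X^N) %/ g))`_m).
  rewrite coefM (big_ord_widen m.+1 (fun i => g`_i * lfrac a g (n - i%:Z))).
    rewrite big_mkcond /=; apply: eq_bigr => i _.
    case: ltnP => hi; last by rewrite nth_default ?mul0r.
    by rewrite (@lfrac_shift a g N _ (m - i)%N) //; have := ltn_ord i; lia.
  by lia.
have := ltn_modp (a * 'X^N) g; rewrite g0 => rg.
have /(congr1 (fun p : {poly F} => p`_m)) := divp_eq (a * 'X^N) g.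
rewrite (mulrC _ g) coefD [in RHS]addrC [in RHS]nth_default ?add0r; last first.
  exact: leq_trans (ltnW rg) sgm.
move=> <-; rewrite coefMXn; case: n NE mE => n NE mE.
  have -> : (m < N)%N = false by lia.
  by congr (_`_ _); lia.
have -> //: (m < N)%N by lia.
Qed.

End Laurent.

Section Characters.

Variables (R : realType) (F : finFieldType).

Definition fchar : nat := s2val (finPcharP F).

Definition fcharP : fchar \in [pchar F] := s2valP' (finPcharP F).

(* Tr_{F/F_p}, with F_p seen inside F. *)
Definition abs_trace (y : F) : F :=
  galTrace 1%VS (fullv : {vspace pPrimeCharType fcharP}) y.

(* For x in the prime field, the k < fchar such that k%:R = x. *)
Definition prime_field_rep (x : F) : nat :=
  index x [seq k%:R | k <- iota 0 fchar].

Definition e_q (y : F) : R[i] :=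
  let t : R := 2 * pi * (prime_field_rep (abs_trace y))%:R / fchar%:R in
  (cos t +i* sin t)%C.

Definition e_inf (alpha : laurent F) : R[i] := e_q (alpha (-1)).

Definition Kl2 (a b : F) : R[i] :=
  \sum_(x : F | x != 0) e_q (a * x + b * x^-1).

Definition num_divisors (f : {poly F}) : nat :=
  #|[set h : {poly_(size f) F} |
      (polyn h \is monic) && (polyn h %| f)%R]%SET|.

End Characters.

Section Meromorphic.

(* Used with C := R[i], whose topology is inferred from its norm only when it
   is seen as a numFieldType. *)
Variable C : numFieldType.

Definition analytic_at (f : C -> C) (z : C) : Prop :=
  exists a : nat -> C, \forall w \near z,
    series (fun k => a k * (w - z) ^+ k) @ \oo --> f w.

Definition pole_at (f : C -> C) (z : C) : Prop :=
  exists (m : nat) (h : C -> C),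
    [/\ (0 < m)%N, analytic_at h z, h z != 0 &
        \forall w \near z^', f w = h w / (w - z) ^+ m].

(* The value of f at a pole is irrelevant. *)
Definition meromorphic (f : C -> C) : Prop :=
  forall z, analytic_at f z \/ pole_at f z.

(* Equality off a set without accumulation points. *)
Definition eq_meromorphic (f g : C -> C) : Prop :=
  forall z : C, \forall w \near z^', f w = g w.

(* Unordered summation over I. *)
Definition sums_to (I : choiceType) (x : I -> C) (s : C) : Prop :=
  partial_sum x A @[A --> totally] --> s.

End Meromorphic.

Section Estermann.

Variables (R : realType) (F : finFieldType).
Local Notation C := R[i].
Local Notation q := (#|F|%:R : C).

(* The term of index f of the series for D_2(u; c/g), extended by 0 to
   non-monic f. *)
Definition estermann_term (c g : {poly F}) (u : C) (f : {poly F}) : C :=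
  if f \is monic then
    (num_divisors f)%:R * e_inf R (lfrac (c * f) g) * u ^+ (size f).-1
  else 0.

(* D is meromorphic on C, and for |u| < 1/q it is the sum of the series. *)
Definition is_estermann (c g : {poly F}) (D : C -> C) : Prop :=
  meromorphic D /\
  forall u : C, `|u| < q^-1 ->
    sums_to (estermann_term c g u) (D u).

Definition estermann (c g : {poly F}) : C -> C :=
  xget (fun=> 0) [set D | is_estermann c g D].

Definition calA (l : F) (u : C) : C :=
  \sum_(e1 < 2) \sum_(e2 < 2)
    (-1) ^+ (e1 + e2)%N *
    (Kl2 R (e1%:R - 1) ((1 - e2%:R) * l) / (q * (1 - q * u) ^+ (e1 + e2)%N)).

End Estermann.

Arguments estermann R {F} c g u.

(* Main.v *)
Require Import Defs.
From mathcomp Require Import all_boot all_order all_algebra all_field.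
From mathcomp Require Import fingroup finmap complex.
From mathcomp Require Import all_classical all_reals all_analysis.
From mathcomp.analysis.showcase Require Import summability.
From mathcomp Require Import ring lra zify.
Import Order.TTheory GRing.Theory Num.Theory.
Import numFieldNormedType.Exports.
Local Open Scope ring_scope.

Set Implicit Arguments.
Unset Strict Implicit.
Unset Printing Implicit Defensive.

(* Put w = 1/(1 - qu), v = 1/(qu), n = deg g, and let psi be the additive
   character a |-> e(a/g), which factors through F[T]/(g).  Writing d(f) as the
   number of factorizations f = ab and summing over residue classes,
     D(u; c/g) = P_c(u) + q^n u^(2n) w^2,
     P_c(u) = sum_(a, b monic of degree < n) psi(cab) u^(deg a + deg b),
   which is meromorphic with a single, double, pole at 1/q.  The Fourier
   transform E(x) = sum_(b monic of degree < n) psi(xb) u^(deg b) is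
     E(x) = w + (qu)^(n - 1 - deg x) (e_q(lead x) - w)   for 0 != x mod g,
   where, x being lambda times a monic y, (qu)^(n - 1 - deg x) is
   (qu)^(n - 1) v^(deg y).  Fourier inversion gives
     q^n P_c(u) = sum_(x, z mod g) E(x) E(z) psi(- cbar x z),
   and inserting the formula for E turns this into the functional equation of
   P_c, in which the product of the coefficients of x and z yields Kl_2.
   A meromorphic function that agrees with this rational function near 0 agrees
   with it off 1/q: each point has a punctured neighbourhood on which their
   difference either vanishes identically or has no zero, and C is connected. *)

(** * The additive character e_q *)

Section AdditiveCharacter.

Variables (R : realType) (F : finFieldType).
Local Notation p := (fchar F).

Lemma fchar_prime : prime p.
Proof. exact: pcharf_prime (fcharP F). Qed.

Lemma abs_traceD : {morph @abs_trace F : x y / x + y}.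
Proof. by move=> x y; rewrite /abs_trace raddfD. Qed.

(** The trace of a Galois extension takes values in the base field, here the prime field, which
    consists of the images of natural numbers. *)
Lemma abs_trace_natr (y : F) : exists k : nat, abs_trace y = k%:R.
Proof.
have galF : galois 1%AS (fullv : {vspace pPrimeCharType (fcharP F)}).
  exact: (finField_galois (sub1v _)).
have /vlineP[a aE] := mem_galTrace galF (memvf (y : pPrimeCharType (fcharP F))).
by exists a; apply: (etrans aE); rewrite -[LHS]/(a%:R * 1 : F) mulr1.
Qed.

(** The trace is the sum of the Galois automorphisms, and by Dedekind independence a combination of
    them with all coefficients 1 is not the zero map. *)
Lemma abs_trace_neq0 : exists y : F, abs_trace y != 0.
Proof.
pose L : splittingFieldType _ := pPrimeCharType (fcharP F).
pose E : {vspace L} := fullv.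
have [a _] := @gal_independent_contra _ L fullv
  [in 'Gal(E / 1%AS)%g] (fun=> 1) 1%g (group1 _) (oner_neq0 L).
rewrite (eq_bigr (fun x : gal_of E => x a)); last by move=> i _; rewrite mul1r.
by exists a.
Qed.

(** In characteristic p the listed elements are pairwise distinct, so [index] recovers the residue
    of k. *)
Lemma prime_field_rep_natr (k : nat) : prime_field_rep (k%:R : F) = (k %% p)%N.
Proof.
have p_gt0 := prime_gt0 fchar_prime.
rewrite /prime_field_rep -(GRing.natr_mod_pchar (fcharP F)).
have kp : (k %% p < size [seq i%:R : F | i <- iota 0 p])%N.
  by rewrite size_map size_iota ltn_pmod.
have -> : (k %% p)%:R = nth 0 [seq i%:R : F | i <- iota 0 p] (k %% p).
  by rewrite (nth_map 0%N) ?size_iota ?nth_iota ?ltn_pmod.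
apply: index_uniq => //; rewrite map_inj_in_uniq ?iota_uniq // => i j.
rewrite !mem_iota !add0n /= => ip jp /eqP.
wlog ij : i j ip jp / (i <= j)%N => [hwlog ijE|].
  by have [/hwlog->|/ltnW/hwlog->] := leqP i j; rewrite // eq_sym.
rewrite eq_sym -subr_eq0 -natrB // -(dvdn_pcharf (fcharP F)).
by move=> /dvdn_leq; lia.
Qed.

(** This is exp(2 pi i k / p). Its periodicity modulo p lets [e_q] be computed from any natural
    number representing the trace. *)
Definition root_of_unity (k : nat) : R[i] :=
  let t : R := 2 * pi * k%:R / p%:R in (cos t +i* sin t)%C.

Lemma root_of_unityD k l :
  root_of_unity (k + l) = root_of_unity k * root_of_unity l.
Proof.
rewrite /root_of_unity natrD mulrDr mulrDl cosD sinD.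
apply/eqP; rewrite eq_complex /= eqxx /=; apply/eqP; ring.
Qed.

Lemma root_of_unity_mod k : root_of_unity (k %% p) = root_of_unity k.
Proof.
rewrite [in RHS](divn_eq k p) root_of_unityD -[LHS]mul1r; congr (_ * _).
have p1 : root_of_unity p = 1.
  have p0 : p%:R != 0 :> R by rewrite pnatr_eq0 -lt0n prime_gt0 ?fchar_prime.
  rewrite /root_of_unity mulfK // mulr_natl.
  by rewrite cos2pi -[pi *+ 2]add0r sinD2pi sin0.
elim: (k %/ p)%N => [|m IH]; last by rewrite mulSn root_of_unityD p1 mul1r.
by rewrite mul0n /root_of_unity mulr0 mul0r cos0 sin0.
Qed.

Lemma e_q_natr (y : F) k : abs_trace y = k%:R -> e_q R y = root_of_unity k.
Proof.
by move=> yk; rewrite -root_of_unity_mod -prime_field_rep_natr -yk.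
Qed.

Lemma e_qD : {morph @e_q R F : x y / x + y >-> x * y}.
Proof.
move=> x y; have [k xk] := abs_trace_natr x; have [l yl] := abs_trace_natr y.
rewrite (e_q_natr xk) (e_q_natr yl) -root_of_unityD.
by apply: e_q_natr; rewrite abs_traceD xk yl natrD.
Qed.

Lemma e_q0 : e_q R (0 : F) = 1.
Proof.
rewrite (@e_q_natr _ 0) /root_of_unity ?mulr0 ?mul0r ?cos0 ?sin0 //.
by rewrite /abs_trace raddf0.
Qed.

Lemma norm_e_q (y : F) : `|e_q R y| = 1.
Proof. by rewrite normc_def /= cos2Dsin2 sqrtr1. Qed.

(** Pick y of nonzero trace, represented by 0 < m < p. The real part of e_q(y) is cos(2 pi m / p) =
    1 - 2 sin(pi m / p)^2, which is below 1 because pi m / p lies strictly between 0 and pi. *)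
Lemma e_q_nontrivial : exists y : F, e_q R y != 1.
Proof.
have [y y0] := abs_trace_neq0; exists y.
have [k yk] := abs_trace_natr y.
have p0 : (0 < p)%N := prime_gt0 fchar_prime.
rewrite (e_q_natr yk) -root_of_unity_mod.
have : (0 < k %% p)%N.
  by rewrite lt0n; move: y0; rewrite yk -(dvdn_pcharf (fcharP F)).
have := ltn_pmod k p0.
move: (k %% p)%N => m mp m0; apply/eqP => /(congr1 (@complex.Re R)) /=.
set t := 2 * pi * _ / _.
have -> : t = (pi * (m%:R / p%:R)) *+ 2 by rewrite /t -mulr_natl; ring.
have s0 : 0 < sin (pi * (m%:R / p%:R)) :> R.
  apply: sin_gt0_pi; rewrite mulr_gt0 ?pi_gt0 ?divr_gt0 ?ltr0n //=.
  by rewrite gtr_pMr ?pi_gt0 // ltr_pdivrMr ?ltr0n // mul1r ltr_nat.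
rewrite cos_mulr2n cos2sin2.
move: (sin (pi * (m%:R / p%:R))) s0 => s s0 h.
have s2 : 0 < s ^+ 2 by rewrite exprn_gt0.
clear -s2 h.
move: (s ^+ 2) s2 h => z z0 h.
lra.
Qed.

(** Translation by some t with e_q(t) != 1 permutes F and multiplies the sum by e_q(t). *)
Lemma sum_e_q : \sum_(y : F) e_q R y = 0.
Proof.
have [t t1] := e_q_nontrivial.
apply/eqP; move: t1; rewrite -subr_eq0 => /mulfI tI.
apply/eqP/tI; rewrite mulr0 mulrBl mul1r big_distrr /=.
rewrite [X in _ - X](reindex_inj (addrI t)) /=.
by apply/eqP; rewrite subr_eq0; apply/eqP/eq_bigr => y _; rewrite e_qD.
Qed.

End AdditiveCharacter.

(** * Character sums modulo g *)

Lemma monic_addXn (F : fieldType) j (r : {poly_j F}) : 'X^j + polyn r \is monic.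
Proof.
by rewrite monicE lead_coefDl ?size_polyXn ?ltnS ?size_npoly ?lead_coefXn.
Qed.

Lemma size_addXn (F : fieldType) j (r : {poly_j F}) : size ('X^j + polyn r) =
  j.+1.
Proof. by rewrite size_polyDl size_polyXn // ltnS size_npoly. Qed.

Section CharacterModulo.

Variables (R : realType) (F : finFieldType) (g : {poly F}) (n : nat).
Hypotheses (g_monic : g \is monic) (size_g : size g = n.+1) (n_gt0 : (0 < n)%N).

Local Notation q := (#|F|%:R : R[i]).

Let g0 : g != 0 := monic_neq0 g_monic.

Let size_mod (a : {poly F}) : (size (a %% g)%R <= n)%N.
Proof. by rewrite -ltnS -size_g ltn_modp. Qed.

Definition psi (a : {poly F}) : R[i] := e_inf R (lfrac a g).

(** As g is monic of degree n, the coefficient of 1/T in a/g is the coefficient of T^(n-1) in the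
    remainder of a. All later evaluations of [psi] go through this formula. *)
Lemma psiE (a : {poly F}) : psi a = e_q R (a %% g)`_n.-1.
Proof.
rewrite /psi /e_inf; congr (e_q R _); rewrite -[LHS]/((a * 'X^1 %/ g)`_0).
have -> : a * 'X^1 = (a %/ g * 'X) * g + (a %% g) * 'X.
  by rewrite expr1 mulrAC -mulrDl -divp_eq.
rewrite divpD mulpK // coefD coefMX /= add0r.
(* Compare the coefficients of T^(n-1) in g times (a mod g)/g. The terms with i < n involve
   nonnegative powers of T in a proper fraction, so they vanish; only the leading coefficient of g
   remains. *)
have := lfracP (a %% g) n.-1%:Z g0; rewrite /= => <-.
rewrite size_g big_ord_recr /= big1 ?add0r => [|i _]; last first.
  rewrite subzn; last by rewrite -ltnS prednK.
  by rewrite /= divp_small ?ltn_modp // coef0 mulr0.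
have -> : n.-1%:Z - n%:Z = -1 by lia.
have -> : g`_n = 1 by move/monicP: g_monic; rewrite lead_coefE size_g.
by rewrite mul1r -[RHS]/((a %% g * 'X^1 %/ g)`_0) expr1.
Qed.

Lemma psiD : {morph psi : a b / a + b >-> a * b}.
Proof. by move=> a b; rewrite !psiE modpD coefD e_qD. Qed.

Lemma psi_mod a : psi (a %% g) = psi a.
Proof. by rewrite !psiE modp_id. Qed.

Lemma psi_dvd a : g %| a -> psi a = 1.
Proof. by rewrite psiE => /modp_eq0P->; rewrite coef0 e_q0. Qed.

Lemma psi_mulmod a b : psi ((a %% g) * b) = psi (a * b).
Proof. by rewrite -psi_mod mulrC modp_mul mulrC psi_mod. Qed.

Lemma norm_psi a : `|psi a| = 1.
Proof. exact: norm_e_q. Qed.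

Lemma psi_small (x b : {poly F}) : (size x + size b <= n)%N -> psi (x * b) = 1.
Proof.
move=> h; have sxb : (size (x * b)%R <= n.-1)%N.
  by apply: leq_trans (size_polyMleq _ _) _; move: h; lia.
rewrite psiE modp_small ?nth_default ?e_q0 //.
by rewrite size_g ltnS; apply: leq_trans sxb (leq_pred _).
Qed.

(** The power of T moves the leading coefficient of x exactly to position n - 1, the one read by
    [psiE]. *)
Lemma psi_lead (x : {poly F}) t : x != 0 -> (size x <= n)%N ->
  psi (x * (t *: 'X^(n - size x))) = e_q R (t * lead_coef x).
Proof.
move=> x0 xn; rewrite -size_poly_gt0 in x0.
rewrite psiE -scalerAr modpZl modp_small; last first.
  rewrite size_Mmonic ?monicXn -?size_poly_gt0 // size_polyXn size_g.
  by rewrite addnS /= subnKC.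
rewrite coefZ coefMXn lead_coefE.
have -> : (n.-1 < n - size x)%N = false by lia.
by congr (e_q R (t * _`_ _)); lia.
Qed.

(** The summation range is stable under translation by s, and s is chosen so that psi(xs) != 1; the
    sum is thus a nontrivial multiple of itself. *)
Lemma sum_psi_eq0 (x b : {poly F}) m : x %% g != 0 -> (n - size (x %% g)%R <
  m)%N ->
  \sum_(r : {poly_m F}) psi (x * (b + polyn r)) = 0.
Proof.
move=> x0 km; have [t t1] := e_q_nontrivial R F.
have l0 : lead_coef (x %% g) != 0 by rewrite lead_coef_eq0.
(* Scaling by the inverse leading coefficient makes psi(xs) = e_q(t); the bound on m says that s
   fits in the summation range. *)
pose s := t / lead_coef (x %% g) *: 'X^(n - size (x %% g)%R) : {poly F}.
have ss : (size s <= m)%N.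
  by apply: leq_trans (size_scale_leq _ _) _; rewrite size_polyXn.
have ps : psi (x * s) = e_q R t.
  by rewrite -psi_mulmod psi_lead // divfK.
move: t1; rewrite -subr_eq0 => /mulfI tI; apply/tI.
rewrite mulr0 mulrBl mul1r big_distrr /=.
rewrite [X in _ - X](reindex_inj (addrI (npolyp m s))) /=.
apply/eqP; rewrite subr_eq0; apply/eqP/eq_bigr => r _.
by rewrite npolypK // addrCA (mulrDr x s) psiD ps.
Qed.

(** Three cases by the degree of the product of x with a monic polynomial of degree j: below n - 1
    the character is 1, at n - 1 it sees only the leading coefficient of x, and beyond it the sum
    cancels. *)
Lemma sum_psi_monic (x : {poly F}) j : x != 0 -> (size x <= n)%N ->
  \sum_(r : {poly_j F}) psi (x * ('X^j + polyn r)) =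
  if (j < n - size x)%N then q ^+ j
  else if j == (n - size x)%N then q ^+ j * e_q R (lead_coef x) else 0.
Proof.
move=> x0 xn; have xg : x %% g = x by rewrite modp_small // size_g.
case: ltngtP => [jk|kj|jk].
- rewrite (eq_bigr (fun=> 1)) => [|r _]; last first.
    by rewrite psi_small // size_addXn; lia.
  by rewrite sumr_const card_npoly -natrX.
- by apply: sum_psi_eq0; rewrite xg.
- rewrite (eq_bigr (fun=> e_q R (lead_coef x))) => [|r _].
    by rewrite sumr_const card_npoly -natrX mulr_natl.
  rewrite mulrDr psiD -[X in psi (x * X) * _]scale1r {1}jk psi_lead // mul1r.
  rewrite psi_small ?mulr1 // -(subnKC xn) leq_add2l -jk.
  exact: size_npoly.
Qed.

(** For j >= n the monic polynomials of degree j are equidistributed among the residue classes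
    modulo g, so this is orthogonality of characters. *)
Lemma sum_psi_large (x : {poly F}) j : (n <= j)%N ->
  \sum_(r : {poly_j F}) psi (x * ('X^j + polyn r)) = (g %| x)%R%:R * q ^+ j.
Proof.
move=> nj; have [gx|gx] := boolP (g %| x).
  rewrite (eq_bigr (fun=> 1)) => [|r _]; last by rewrite psi_dvd // dvdp_mulr.
  by rewrite sumr_const card_npoly -natrX mul1r.
rewrite mul0r; apply: sum_psi_eq0 => //.
by have : x %% g != 0 by []; rewrite -size_poly_gt0; lia.
Qed.

Lemma sum_psi_residues x :
  \sum_(r : {poly_n F}) psi (x * polyn r) = (g %| x)%R%:R * q ^+ n.
Proof.
have [gx|gx] := boolP (g %| x).
  rewrite (eq_bigr (fun=> 1)) => [|r _]; last by rewrite psi_dvd // dvdp_mulr.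
  by rewrite sumr_const card_npoly -natrX mul1r.
rewrite mul0r (eq_bigr (fun r => psi (x * (0 + polyn r)))) => [|r _];
  last first.
  by rewrite add0r.
apply: sum_psi_eq0 => //.
by have : x %% g != 0 by []; rewrite -size_poly_gt0; lia.
Qed.

End CharacterModulo.

(** * The functional equation of the finite part *)

Lemma geometric_sum (K : fieldType) (z : K) m : 1 - z != 0 ->
  \sum_(j < m) z ^+ j = (1 - z)^-1 * (1 - z ^+ m).
Proof.
by move=> z1; rewrite -[1 - z ^+ m]opprB subrX1 -mulNr opprB mulKf.
Qed.

(** * Sums over monic polynomials, sorted by degree *)

Section MonicSums.

Variables (F : finFieldType) (A : nmodType).

(** A monic polynomial is determined by its degree j and its terms below ['X^j]. The inner sums then
    run over vector spaces, where translation arguments apply. *)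
Lemma big_monic (m : nat) (G : {poly F} -> A) :
  \sum_(a : {poly_m F} | polyn a \is monic) G (polyn a) =
  \sum_(j < m) \sum_(r : {poly_j F}) G ('X^j + polyn r).
Proof.
case: m => [|m].
  rewrite big_ord0 big_pred0 // => a; apply/negP => /monic_neq0.
  by rewrite -size_poly_eq0 -leqn0 size_npoly.
pose d (a : {poly_m.+1 F}) : 'I_m.+1 := inord (size (polyn a)).-1.
have dE (a : {poly_m.+1 F}) : polyn a \is monic -> size (polyn a) = (d a).+1.
  move=> /monic_neq0; rewrite -size_poly_gt0 => a0.
  by rewrite inordK prednK // size_npoly.
rewrite (partition_big d xpredT) //=; apply: eq_bigr => j _.
have hE (r : {poly_j F}) : polyn (npolyp m.+1 ('X^j + polyn r)) = 'X^j + polyn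
  r.
  by rewrite npolypK // size_addXn.
rewrite (reindex_onto (fun r : {poly_j F} => npolyp m.+1 ('X^j + polyn r))
  (fun a => npolyp j (polyn a))) => [|a /andP[a_mon /eqP aj]] /=; last first.
  apply/val_inj; rewrite /= hE; apply/polyP => i.
  rewrite coefD coefXn coef_npolyp; have [ij|ji|->] := ltngtP i j.
  - by rewrite add0r.
  - by rewrite addr0 nth_default // dE // aj.
  - by have := monicP a_mon; rewrite lead_coefE dE // aj addr0.
apply: eq_big => [r|r _]; last by rewrite hE.
rewrite /= hE; apply/andP; split; last first.
  apply/eqP/val_inj/polyP => i /=; rewrite coef_npolyp coefD coefXn.
  by case: ltngtP => ij; rewrite ?add0r // nth_default ?(leq_trans (size_npoly
    r)) ?ij // ltnW.
by rewrite monic_addXn; apply/eqP/val_inj/eqP;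
  rewrite -eqSS /= -dE hE ?size_addXn ?monic_addXn.
Qed.

Lemma big_neq0_monic (m : nat) (G : {poly F} -> A) :
  \sum_(a : {poly_m F} | polyn a != 0) G (polyn a) =
  \sum_(l : F | l != 0) \sum_(a : {poly_m F} | polyn a \is monic)
    G (l *: polyn a).
Proof.
rewrite (partition_big (fun a => lead_coef (polyn a)) (fun l => l != 0)) /=.
  apply: eq_bigr => l l0; have lI : l^-1 != 0 by rewrite invr_eq0.
  rewrite (reindex_onto (fun a : {poly_m F} => l *: a)
    (fun a : {poly_m F} => l^-1 *: a)) => [|a _] /=; last first.
    by rewrite scalerA divff // scale1r.
  apply: eq_bigl => a; rewrite scalerA mulVf // scale1r eqxx andbT.
  rewrite lead_coefZ monicE -[X in _ && (_ == X)]mulr1 (inj_eq (mulfI l0)).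
  have [a1|_] := eqVneq (lead_coef _) 1; rewrite ?andbF // andbT.
  by rewrite scaler_eq0 negb_or l0 -lead_coef_eq0 a1 oner_eq0.
by move=> a a0; rewrite lead_coef_eq0.
Qed.

End MonicSums.

(** * Kloosterman sums and the coefficients [calA] *)

Section Kloosterman.

Variables (R : realType) (F : finFieldType).

Local Notation q := (#|F|%:R : R[i]).
Local Notation Kl2 := (@Kl2 R F).

Lemma sum_e_q_neq0 (a : F) : a != 0 -> \sum_(x : F | x != 0) e_q R (a * x) = -1.
Proof.
move=> a0; have : \sum_(x : F) e_q R (a * x) = 0.
  rewrite -[RHS](sum_e_q R F) [RHS](reindex_onto ( *%R a) ( *%R a^-1)) => [|x
    _].
    by apply: eq_bigl => x /=; rewrite mulKf ?eqxx.
  by rewrite mulVKf.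
by rewrite (bigD1 0) //= mulr0 e_q0 => /eqP; rewrite addrC addr_eq0 => /eqP.
Qed.

Lemma sum_e_q_inv (b : F) : b != 0 ->
  \sum_(x : F | x != 0) e_q R (b * x^-1) = -1.
Proof.
move=> b0; rewrite -(sum_e_q_neq0 b0) (reindex_inj invr_inj) /=.
by apply: eq_big => [x|x _]; rewrite ?invrK ?invr_eq0.
Qed.

Lemma card_field_neq0 : \sum_(x : F | x != 0) (1 : R[i]) = q - 1.
Proof.
have : \sum_(x : F) (1 : R[i]) = q by rewrite sumr_const.
by rewrite (bigD1 0) //= => <-; rewrite addrAC subrr add0r.
Qed.

Lemma Kl2_0r (a : F) : a != 0 -> Kl2 a 0 = -1.
Proof.
move=> a0; rewrite -(sum_e_q_neq0 a0).
by apply: eq_bigr => x _; rewrite mul0r addr0.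
Qed.

Lemma Kl2_0l (b : F) : b != 0 -> Kl2 0 b = -1.
Proof.
move=> b0; rewrite -(sum_e_q_inv b0).
by apply: eq_bigr => x _; rewrite mul0r add0r.
Qed.

Lemma Kl2_00 : Kl2 0 0 = q - 1.
Proof.
rewrite -card_field_neq0; apply: eq_bigr => x _.
by rewrite !mul0r addr0 e_q0.
Qed.

(** Exchanging the sums, the sum of e_q(l/x) over l != 0 is -1, and so is the remaining sum of
    e_q(ax). *)
Lemma sum_Kl2 (a : F) : a != 0 -> \sum_(l : F | l != 0) Kl2 a l = 1.
Proof.
move=> a0; rewrite exchange_big /=.
rewrite (eq_bigr (fun x => - e_q R (a * x))) => [|x x0].
  by rewrite sumrN sum_e_q_neq0 // opprK.
have xV : x^-1 != 0 by rewrite invr_eq0.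
rewrite -mulrN1 -(sum_e_q_neq0 xV) big_distrr /=.
by apply: eq_bigr => l _; rewrite e_qD (mulrC l).
Qed.

Lemma card_field_complex_neq0 : q != 0.
Proof. by rewrite pnatr_eq0 -lt0n; apply/card_gt0P; exists 0. Qed.

(** Of the four terms, only the first is a genuine Kloosterman sum; a single zero argument gives -1
    and two give q - 1. *)
Lemma calAE (l : F) (u : R[i]) (w := (1 - q * u)^-1) : l != 0 ->
  calA l u = (Kl2 (-1) l + 2 * w + (q - 1) * w ^+ 2) / q.
Proof.
move=> l0; have m1 : -1 != 0 :> F by rewrite oppr_eq0 oner_eq0.
rewrite /calA !big_ord_recl !big_ord0 /= /bump /=.
rewrite !(subr0, sub0r, subrr, mul1r, mul0r, addr0, addn0, add0n, expr0, expr1).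
rewrite Kl2_0r // Kl2_0l // Kl2_00 !invfM -/w invr1.
ring.
Qed.

(** The source of the Kloosterman sum: the product of the two characters becomes Kl_2(-1, l) after x
    is replaced by -x, and the terms containing w are complete up to x = 0. In [sum_weight], x and
    -(l/x) are the leading coefficients of the two Fourier variables. *)
Lemma calA_conv (l : F) (u : R[i]) (w := (1 - q * u)^-1) : l != 0 ->
  \sum_(x : F | x != 0) (e_q R x - w) * (e_q R (- (l / x)) - w) =
  q * calA l u.
Proof.
move=> l0; rewrite calAE // mulrCA mulfV ?card_field_complex_neq0 // mulr1 -/w.
transitivity (\sum_(x : F | x != 0) (e_q R x * e_q R (- (l / x)) +
    (- w * e_q R (1 * x) + (- w * e_q R (- l * x^-1) + w ^+ 2 * 1)))).
  by apply: eq_bigr => x _; rewrite mul1r (mulNr l); ring.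
rewrite !big_split /= -!big_distrr /=.
rewrite sum_e_q_neq0 ?oner_eq0 // sum_e_q_inv ?oppr_eq0 // card_field_neq0.
have -> : \sum_(x : F | x != 0) e_q R x * e_q R (- (l / x)) = Kl2 (-1) l.
  rewrite /Defs.Kl2 [RHS](reindex_inj oppr_inj) /=.
  apply: eq_big => [x|x _]; first by rewrite oppr_eq0.
  by rewrite -e_qD invrN mulrNN mul1r mulrN.
ring.
Qed.

(** With w = 1/(1 - qu) the sum is (1 + (q - 1)w)^2 / q, a perfect square. It serves to sum the
    polar terms on the dual side, which do not depend on l. *)
Lemma sum_calA (u : R[i]) : 1 - q * u != 0 ->
  \sum_(l : F | l != 0) calA l u = q * (u - 1) ^+ 2 / (1 - q * u) ^+ 2.
Proof.
move=> qu1; have q0 := card_field_complex_neq0.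
have m1 : -1 != 0 :> F by rewrite oppr_eq0 oner_eq0.
rewrite (eq_bigr _ (fun l => @calAE l u)) -big_distrl /=.
set w := (1 - q * u)^-1.
rewrite (eq_bigr (fun l => Kl2 (-1) l + (2 * w + (q - 1) * w ^+ 2) * 1)).
  rewrite big_split -big_distrr /= sum_Kl2 // card_field_neq0 /w.
  by field; apply/andP; split.
by move=> l _; rewrite mulr1 addrA.
Qed.

Lemma calA_closed_form (l : F) (u : R[i]) : l != 0 -> 1 - q * u != 0 ->
  calA l u = Kl2 (-1) l / q + (1 + q - 2 * q * u) / (q * (1 - q * u) ^+ 2).
Proof.
move=> l0 qu1; rewrite calAE //; field.
by apply/andP; split=> //; exact: card_field_complex_neq0.
Qed.

End Kloosterman.

(** * Fourier analysis modulo g and the functional equation of P_c *)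

Section FunctionalEquation.

Variables (R : realType) (F : finFieldType) (g : {poly F}) (n : nat).
Hypotheses (g_monic : g \is monic) (size_g : size g = n.+1) (n_gt0 : (0 < n)%N).

Local Notation q := (#|F|%:R : R[i]).
Local Notation psi := (psi R g).

(** Extending u^(deg a) by 0 off the monic polynomials makes it a function on all residues modulo g,
    to which Fourier inversion and changes of variable apply. *)
Definition mon (u : R[i]) (a : {poly F}) : R[i] :=
  if a \is monic then u ^+ (size a).-1 else 0.

(* The P_c(u) of the proof sketch; [monic_fourier] is its E. *)
Definition estermann_fin (c : {poly F}) (u : R[i]) : R[i] :=
  \sum_(a : {poly_n F}) \sum_(b : {poly_n F})
    mon u (polyn a) * mon u (polyn b) * psi (c * (polyn a * polyn b)).

Definition monic_fourier (u : R[i]) (x : {poly F}) : R[i] :=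
  \sum_(b : {poly_n F}) mon u (polyn b) * psi (x * polyn b).

Lemma monic_fourierE u x : monic_fourier u x =
  \sum_(j < n) u ^+ j * \sum_(r : {poly_j F}) psi (x * ('X^j + polyn r)).
Proof.
transitivity (\sum_(b : {poly_n F} | polyn b \is monic)
    u ^+ (size (polyn b)).-1 * psi (x * polyn b)).
  rewrite big_mkcond; apply: eq_bigr => b _; rewrite /mon.
  by case: ifP; rewrite // mul0r.
rewrite (big_monic n (fun b : {poly F} => u ^+ (size b).-1 * psi (x * b))).
apply: eq_bigr => j _; rewrite big_distrr; apply: eq_bigr => r _ /=.
by rewrite size_addXn.
Qed.

Lemma monic_fourier_mod u x : monic_fourier u (x %% g) = monic_fourier u x.
Proof.
by apply: eq_bigr => b _; rewrite (psi_mulmod R g_monic size_g n_gt0).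
Qed.

Lemma monic_fourier0 u : 1 - q * u != 0 ->
  monic_fourier u 0 = (1 - q * u)^-1 * (1 - (q * u) ^+ n).
Proof.
move=> qu1; rewrite monic_fourierE -geometric_sum //.
apply: eq_bigr => j _; rewrite (eq_bigr (fun=> 1)) => [|r _].
  by rewrite sumr_const card_npoly natrX mulrC -exprMn.
by rewrite mul0r (psi_dvd R g_monic size_g n_gt0) ?dvdp0.
Qed.

(** With k = n - size x, [sum_psi_monic] gives (qu)^j for each degree j < k, the term (qu)^k
    e_q(lead x) for j = k, and 0 beyond. The first terms form a geometric sum. *)
Lemma monic_fourier_neq0 u (x : {poly F}) : 1 - q * u != 0 -> x != 0 -> (size x
  <= n)%N ->
  monic_fourier u x = (1 - q * u)^-1 +
    (q * u) ^+ (n - size x) * (e_q R (lead_coef x) - (1 - q * u)^-1).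
Proof.
move=> qu1 x0 xn; rewrite monic_fourierE.
set k := (n - size x)%N.
(* Since x != 0, the boundary degree k is among the degrees below n. *)
have kn : (k < n)%N by rewrite -size_poly_gt0 in x0; rewrite /k; lia.
transitivity (\sum_(j < n | (j < k.+1)%N) (if (j < k)%N then (q * u) ^+ j
    else (q * u) ^+ k * e_q R (lead_coef x))).
  rewrite [RHS]big_mkcond; apply: eq_bigr => j _.
  rewrite (sum_psi_monic R g_monic size_g n_gt0) // -/k ltnS.
  case: ltngtP => [jk|jk|->]; last by rewrite mulrA exprMn (mulrC (u ^+ _)).
    by rewrite exprMn mulrC.
  by rewrite mulr0.
rewrite -(big_ord_widen _ (fun j => if (j < k)%N then (q * u) ^+ j
    else (q * u) ^+ k * e_q R (lead_coef x))) //.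
rewrite big_ord_recr /= ltnn (eq_bigr (fun j : 'I_k => (q * u) ^+ j)) => [|j _].
  by rewrite geometric_sum //; ring.
by rewrite ltn_ord.
Qed.

(** Fourier inversion on F[T]/(g): summing over z isolates the b congruent to a modulo g, which for
    b of size at most n means b = a mod g. *)
Lemma monic_fourier_inv u a :
  \sum_(z : {poly_n F}) monic_fourier u (polyn z) * psi (- (a * polyn z)) =
  q ^+ n * mon u (a %% g).
Proof.
have sa : (size (a %% g)%R <= n)%N.
  by rewrite -ltnS -size_g ltn_modp monic_neq0.
rewrite (eq_bigr (fun z : {poly_n F} => \sum_(b : {poly_n F})
    mon u (polyn b) * psi ((polyn b - a) * polyn z))); last first.
  move=> z _; rewrite big_distrl; apply: eq_bigr => b _ /=.
  by rewrite -mulrA -(psiD R g_monic size_g n_gt0) mulrBl (mulrC (polyn b)).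
have gb (b : {poly_n F}) : (g %| polyn b - a) = (polyn b == a %% g).
  rewrite /dvdp modpD modpN modp_small ?subr_eq0 //.
  by rewrite size_g ltnS size_npoly.
rewrite exchange_big /= (bigD1 (npolyp n (a %% g))) //= [X in _ + X]big1.
  rewrite addr0 -big_distrr (sum_psi_residues R g_monic size_g n_gt0) /=.
  by rewrite gb npolypK // eqxx mul1r mulrC.
move=> b ba; rewrite -big_distrr (sum_psi_residues R g_monic size_g n_gt0) /=.
rewrite gb; case: eqP => [bag|_]; last by rewrite mul0r mulr0.
by case/eqP: ba; apply/val_inj; rewrite /= bag npolypK.
Qed.

Lemma mon0 u : mon u 0 = 0.
Proof. by rewrite /mon monicE lead_coef0 eq_sym oner_eq0. Qed.

(** Inversion at a = 0, where [mon] vanishes. *)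
Lemma sum_monic_fourier u : \sum_(x : {poly_n F}) monic_fourier u (polyn x) = 0.
Proof.
have e := monic_fourier_inv u 0; rewrite mod0p mon0 mulr0 in e.
apply: etrans e.
by apply: eq_bigr => x _; rewrite mul0r oppr0 (psi_dvd R g_monic size_g n_gt0)
  ?dvdp0 ?mulr1.
Qed.

(** The sum over b in P_c(u) is E(ca). Substituting a = cbar x, a bijection of the residues modulo
    g, turns this into E(x), and the factor [mon] at cbar x is expanded by Fourier inversion. *)
Lemma estermann_fin_fourier c cbar u : g %| c * cbar - 1 ->
  q ^+ n * estermann_fin c u =
  \sum_(x : {poly_n F}) \sum_(z : {poly_n F})
    monic_fourier u (polyn x) * monic_fourier u (polyn z) *
    psi (- (cbar * polyn x * polyn z)).
Proof.
move=> cbarP.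
have size_mod a : (size (a %% g)%R <= n)%N.
  by rewrite -ltnS -size_g ltn_modp monic_neq0.
have small (x : {poly_n F}) : polyn x %% g = polyn x.
  by rewrite modp_small // size_g ltnS size_npoly.
have inv (a b x : {poly F}) : g %| a * b - 1 -> a * ((b * x) %% g) %% g = x %%
  g.
  move=> ab; rewrite modp_mul mulrA -[a * b](subrK 1) mulrDl mul1r modpD.
  by rewrite [_ * x %% g]modp_eq0 ?add0r // dvdp_mulr.
have cP (x : {poly F}) : c * ((cbar * x) %% g) %% g = x %% g by apply: inv.
have cbarP' (x : {poly F}) : cbar * ((c * x) %% g) %% g = x %% g.
  by apply: inv; rewrite mulrC.
transitivity (\sum_(x : {poly_n F}) monic_fourier u (polyn x) *
    (q ^+ n * mon u ((cbar * polyn x) %% g))); last first.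
  apply: eq_bigr => x _; rewrite -monic_fourier_inv big_distrr /=.
  by apply: eq_bigr => z _; rewrite mulrA.
transitivity (q ^+ n * \sum_(a : {poly_n F})
    mon u (polyn a) * monic_fourier u (c * polyn a)).
  congr (_ * _); apply: eq_bigr => a _; rewrite big_distrr /=.
  by apply: eq_bigr => b _; rewrite !mulrA.
rewrite big_distrr /=.
rewrite (reindex_onto (fun x : {poly_n F} => npolyp n ((cbar * polyn x) %% g))
  (fun a : {poly_n F} => npolyp n ((c * polyn a) %% g))) /=.
  apply: eq_big => [x|x _].
    by apply/eqP/val_inj; rewrite /= !npolypK // cP small.
  by rewrite npolypK // -[monic_fourier u (c * _)]monic_fourier_mod cP small;
    ring.
by move=> a _; apply/val_inj; rewrite /= !npolypK // cbarP' small.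
Qed.

Lemma estermann_fin_monic c u : estermann_fin c u =
  \sum_(a : {poly_n F} | polyn a \is monic)
  \sum_(b : {poly_n F} | polyn b \is monic)
    mon u (polyn a) * mon u (polyn b) * psi (c * (polyn a * polyn b)).
Proof.
rewrite [RHS]big_mkcond; apply: eq_bigr => a _; case: ifP => a_mon; last first.
  by rewrite big1 // => b _; rewrite {1}/mon a_mon !mul0r.
rewrite [RHS]big_mkcond; apply: eq_bigr => b _.
by case: ifP => // b_mon; rewrite {2}/mon b_mon mulr0 mul0r.
Qed.

(** The part of E(x) beyond the constant w, for x != 0. *)
Definition weight (u : R[i]) (x : {poly F}) : R[i] :=
  (q * u) ^+ (n - size x) * (e_q R (lead_coef x) - (1 - q * u)^-1).

(** Write x and z as scalars l, k times monic a, b. Each weight becomes (qu)^(n-1) (e_q(l) - w)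
    v^(deg a) with v = 1/(qu), so the sums over a and b give P at v with c scaled by -lk. Grouping
    by this scalar leaves the sum of [calA_conv]. *)
Lemma sum_weight c u : u != 0 -> 1 - q * u != 0 ->
  \sum_(x : {poly_n F} | polyn x != 0) \sum_(z : {poly_n F} | polyn z != 0)
    weight u (polyn x) * weight u (polyn z) * psi (- (c * polyn x * polyn z)) =
  (q * u) ^+ (n.-1 * 2) * q *
    \sum_(l : F | l != 0) calA l u * estermann_fin (l *: c) (1 / (q * u)).
Proof.
move=> u0 qu1; set w := (1 - q * u)^-1; set v := 1 / (q * u).
have qu0 : q * u != 0 by rewrite mulf_neq0 // card_field_complex_neq0.
have weightE (l : F) (a : {poly_n F}) : l != 0 -> polyn a \is monic ->
    weight u (l *: polyn a) =
    (q * u) ^+ n.-1 * (e_q R l - w) * mon v (polyn a).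
  move=> l0 a_mon; rewrite /weight /mon a_mon size_scale // lead_coefZ.
  rewrite (monicP a_mon) mulr1 -/w mulrAC; congr (_ * _).
  have a0 : (0 < size (polyn a))%N by rewrite size_poly_gt0 monic_neq0.
  rewrite /v div1r exprVn; apply: (mulIf (expf_neq0 (size (polyn a)).-1 qu0)).
  rewrite mulfVK ?expf_neq0 // -exprD; congr (_ ^+ _).
  by move: a0 (size_npoly a); case: (size _) => // m _ mn /=; lia.
rewrite (big_neq0_monic n (fun x : {poly F} => \sum_(z : {poly_n F} | polyn z
  != 0)
    weight u x * weight u (polyn z) * psi (- (c * x * polyn z)))).
transitivity (\sum_(l : F | l != 0) \sum_(k : F | k != 0)
    ((q * u) ^+ n.-1) ^+ 2 * ((e_q R l - w) * (e_q R k - w)) *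
    estermann_fin ((- (l * k)) *: c) v).
  apply: eq_bigr => l l0.
  under eq_bigr => a a_mon do rewrite (big_neq0_monic n (fun z : {poly F} =>
    weight u (l *: polyn a) * weight u z * psi (- (c * (l *: polyn a) * z)))).
  rewrite exchange_big /=; apply: eq_bigr => k k0.
  rewrite estermann_fin_monic big_distrr; apply: eq_bigr => a a_mon.
  rewrite big_distrr; apply: eq_bigr => b b_mon /=.
  rewrite !weightE //.
  have -> : - (c * (l *: polyn a) * (k *: polyn b)) =
    - (l * k) *: c * (polyn a * polyn b).
    by rewrite -!mul_polyC polyCN polyCM; ring.
  ring.
(* With the first leading coefficient x fixed, the second is written -(l/x), so that l is minus the
   product of the two. *)
transitivity (\sum_(l : F | l != 0) \sum_(x : F | x != 0)
    ((q * u) ^+ n.-1) ^+ 2 * ((e_q R x - w) * (e_q R (- (l / x)) - w)) *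
    estermann_fin (l *: c) v).
  rewrite [RHS]exchange_big; apply: eq_bigr => l l0 /=.
  have lI : - l^-1 != 0 by rewrite oppr_eq0 invr_eq0.
  rewrite (reindex_onto (fun k => - l^-1 * k) (fun k => - l * k)) /=.
    apply: eq_big => [k|k /andP[_ _]].
      by rewrite mulrA mulrNN divff // mul1r eqxx andbT mulf_eq0 (negbTE lI).
    by rewrite [- l^-1 * k]mulNr mulrN opprK mulVKf // (mulrC l^-1).
  by move=> k _; rewrite mulrA mulrNN mulVf // mul1r.
rewrite big_distrr; apply: eq_bigr => l l0 /=.
by rewrite -big_distrl -big_distrr calA_conv //= exprM; ring.
Qed.

(** Insert E = w + weight into [estermann_fin_fourier]. Besides the double sum of [sum_weight],
    there remain -E(0)^2 - w^2 (q^n - 1) - 2 w beta with beta = -E(0) - w (q^n - 1). As E(0) = w(1 -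
    U), this collapses to w^2 (q^n - U^2). *)
Lemma estermann_fin_eq c cbar u : g %| c * cbar - 1 ->
  u != 0 -> 1 - q * u != 0 ->
  estermann_fin c u = (1 - q ^+ n * u ^+ (n * 2)) / (1 - q * u) ^+ 2 +
    (q * u ^+ 2) ^+ n.-1 *
    \sum_(l : F | l != 0) calA l u * estermann_fin (l *: cbar) (1 / (q * u)).
Proof.
move=> cbarP u0 qu1.
have q0 : q != 0 by exact: card_field_complex_neq0.
set w := (1 - q * u)^-1; set U := (q * u) ^+ n.
have E0 : monic_fourier u 0 = w * (1 - U) by rewrite monic_fourier0.
have EE (x : {poly_n F}) : polyn x != 0 ->
    monic_fourier u (polyn x) = w + weight u (polyn x).
  by move=> x0; rewrite monic_fourier_neq0 // size_npoly.
have sumE : \sum_(x : {poly_n F} | polyn x != 0) monic_fourier u (polyn x) =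
    - (w * (1 - U)).
  have := sum_monic_fourier u; rewrite (bigD1 0) //= E0 => /eqP.
  by rewrite addrC addr_eq0 => /eqP <-.
have psi0 (x : {poly F}) : x = 0 -> psi x = 1.
  by move=> ->; rewrite (psi_dvd R g_monic size_g n_gt0) ?dvdp0.
(* Since cbar is invertible modulo g, g does not divide cbar x; the complete sum over z is 0 and its
   term at z = 0 is 1. *)
have sum_psi (x : {poly_n F}) : polyn x != 0 ->
    \sum_(z : {poly_n F} | polyn z != 0) psi (- (cbar * polyn x * polyn z)) =
      -1.
  move=> x0; have := sum_psi_residues R g_monic size_g n_gt0 (- (cbar * polyn
    x)).
  have -> : (g %| - (cbar * polyn x)) = false.
    apply/negP; rewrite dvdpNr => gx; suff : g %| polyn x.
      by move/(dvdp_leq x0); rewrite size_g leqNgt ltnS size_npoly.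
    have -> : polyn x = c * (cbar * polyn x) - (c * cbar - 1) * polyn x by ring.
    by apply: dvdp_sub; [apply: dvdp_mull | apply: dvdp_mulr].
  rewrite mul0r (bigD1 0) //= psi0 ?mulr0 // => /eqP.
  rewrite addrC addr_eq0 => /eqP <-.
  by apply: eq_bigr => z _; rewrite mulNr.
have sum1 : \sum_(x : {poly_n F} | polyn x != 0) (1 : R[i]) = q ^+ n - 1.
  have : \sum_(x : {poly_n F}) (1 : R[i]) = q ^+ n.
    by rewrite sumr_const card_npoly natrX.
  by rewrite (bigD1 0) //= => <-; rewrite addrAC subrr add0r.
pose beta := \sum_(x : {poly_n F} | polyn x != 0) weight u (polyn x).
have betaE : beta = - (w * (1 - U)) - w * (q ^+ n - 1).
  rewrite -sumE -sum1 big_distrr -sumrB; apply: eq_bigr => x x0 /=.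
  by rewrite EE // mulr1 addrAC subrr add0r.
apply: (mulfI (expf_neq0 n q0)); rewrite (estermann_fin_fourier _ cbarP).
pose T x z := psi (- (cbar * x * z)).
have TC x z : T x z = T z x by rewrite /T mulrAC.
(* The terms with x = 0, then those with z = 0, are split off; on the rest both factors expand as w
   + weight. *)
transitivity (monic_fourier u 0 * \sum_(z : {poly_n F}) monic_fourier u (polyn
  z) +
    \sum_(x : {poly_n F} | polyn x != 0) (monic_fourier u (polyn x) *
      monic_fourier u 0 +
      (w ^+ 2 * \sum_(z : {poly_n F} | polyn z != 0) T (polyn x) (polyn z) +
       (w * (weight u (polyn x) * \sum_(z : {poly_n F} | polyn z != 0) T (polyn
         x) (polyn z)) +
        (w * (\sum_(z : {poly_n F} | polyn z != 0) weight u (polyn z) * T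
          (polyn x) (polyn z)) +
         \sum_(z : {poly_n F} | polyn z != 0)
           weight u (polyn x) * weight u (polyn z) * T (polyn x) (polyn z)))))).
  rewrite (bigD1 0) //=; congr (_ + _).
    rewrite big_distrr; apply: eq_bigr => z _ /=.
    by rewrite psi0 ?mulr1 // mulr0 mul0r oppr0.
  apply: eq_bigr => x x0; rewrite (bigD1 0) //=; congr (_ + _).
    by rewrite psi0 ?mulr1 // mulr0 oppr0.
  rewrite !big_distrr -!big_split; apply: eq_bigr => z z0 /=.
  by rewrite !EE // -/(T _ _); ring.
rewrite sum_monic_fourier mulr0 add0r !big_split /= -!big_distrr -!big_distrl
  /=.
rewrite sumE (eq_bigr (fun=> -1 * 1)) => [|x x0]; last by rewrite mulr1 sum_psi.
rewrite -big_distrr sum1 /=.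
rewrite (eq_bigr (fun x => -1 * weight u (polyn x))) => [|x x0]; last first.
  by rewrite [T _]/T sum_psi // mulrC.
rewrite -big_distrr /= -/beta exchange_big /=.
rewrite (eq_bigr (fun x => -1 * weight u (polyn x))) => [|x x0]; last first.
  rewrite -big_distrr /= mulrC; congr (_ * _); rewrite -(sum_psi _ x0).
  by apply: eq_bigr => z _; rewrite TC.
rewrite -big_distrr /= -/beta sum_weight // betaE E0.
set S := \sum_(l | _) _.
have q2 : q ^+ n * (q * u ^+ 2) ^+ n.-1 = (q * u) ^+ (n.-1 * 2) * q.
  rewrite -[in q ^+ n](prednK n_gt0) exprS exprM !exprMn.
  ring.
have -> : q ^+ n * ((1 - q ^+ n * u ^+ (n * 2)) / (1 - q * u) ^+ 2 +
    (q * u ^+ 2) ^+ n.-1 * S) =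
    q ^+ n * (1 - q ^+ n * u ^+ (n * 2)) * w ^+ 2 +
    (q * u) ^+ (n.-1 * 2) * q * S.
  by rewrite -q2 /w exprVn; ring.
have -> : u ^+ (n * 2) = u ^+ n ^+ 2 by rewrite exprM.
have -> : U = q ^+ n * u ^+ n by rewrite /U exprMn.
ring.
Qed.

(** At the pole 1/q the quotient is 0 by the convention on division, so the value there is only a
    default. *)
Definition estermann_rat (c : {poly F}) (u : R[i]) : R[i] :=
  estermann_fin c u + q ^+ n * u ^+ (n * 2) / (1 - q * u) ^+ 2.

(** Adding the polar term q^n u^(2n) w^2 to [estermann_fin_eq] leaves w^2 as the elementary term on
    the right. By [sum_calA] this is exactly the total of the dual polar terms. The point u = 1 is
    excluded because 1/(qu) is then the pole 1/q. *)
Lemma estermann_rat_eq c cbar u : g %| c * cbar - 1 ->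
  u != 0 -> 1 - q * u != 0 -> u != 1 ->
  estermann_rat c u = (q * u ^+ 2) ^+ n.-1 *
    \sum_(l : F | l != 0) calA l u * estermann_rat (l *: cbar) (1 / (q * u)).
Proof.
move=> cbarP u0 qu1 u1; have q0 := card_field_complex_neq0 R F.
rewrite {1}/estermann_rat (estermann_fin_eq cbarP u0 qu1).
under [X in _ = _ * X]eq_bigr => l _ do rewrite /estermann_rat mulrDr.
rewrite [X in _ = _ * X]big_split -big_distrl /= sum_calA // mulrDr.
set S := (_ * \sum_(l | _) _).
have qu0 : q * u != 0 by rewrite mulf_neq0.
have u1' : u - 1 != 0 by rewrite subr_eq0.
have -> : 1 - q * (1 / (q * u)) = (u - 1) / u by field; rewrite u0.
set K := (q * u ^+ 2) ^+ n.-1.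
have KE : K * q * q ^+ n * u ^+ 2 = (q * u) ^+ (n * 2).
  rewrite exprM [(q * u) ^+ n]exprMn /K -(prednK n_gt0) /=.
  rewrite (exprS q) (exprS u n.-1) !exprMn.
  ring.
have -> : (1 / (q * u)) ^+ (n * 2) = ((q * u) ^+ (n * 2))^-1.
  by rewrite div1r exprVn.
have K0 : K != 0 by rewrite expf_neq0 ?mulf_neq0 ?expf_neq0.
have qn0 : q ^+ n != 0 by rewrite expf_neq0.
have -> : K * (q * (u - 1) ^+ 2 / (1 - q * u) ^+ 2 * (q ^+ n / (q * u) ^+ (n *
  2)
    / ((u - 1) / u) ^+ 2)) = (1 - q * u) ^- 2.
  rewrite -KE; clearbody K; field.
  by do ![apply/andP; split].
by rewrite mulrBl mul1r; ring.
Qed.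

End FunctionalEquation.

(** * Coefficients of the Estermann series *)

Lemma big_triangle (A : nmodType) (m : nat) (a : nat -> nat -> A) :
  \sum_(k < m) \sum_(i < k.+1) a i (k - i)%N =
  \sum_(i < m) \sum_(j < m - i) a i j.
Proof.
elim: m => [|m IH]; first by rewrite !big_ord0.
rewrite big_ord_recr IH [RHS]big_ord_recr /= subSnn big_ord1 /=.
rewrite [X in _ + X]big_ord_recr /= subnn addrA; congr (_ + _).
rewrite -big_split; apply: eq_bigr => i _.
by rewrite subSn 1?ltnW // big_ord_recr.
Qed.

Lemma big_ord_indic (A : nzRingType) (m k : nat) (f : nat -> A) : (k <= m)%N ->
  \sum_(j < m) (j < k)%N%:R * f j = \sum_(j < k) f j.
Proof.
move=> km; rewrite (big_ord_widen _ f km) [RHS]big_mkcond.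
by apply: eq_bigr => j _; case: ifP; rewrite ?mul1r ?mul0r.
Qed.

(** * Divisor sums as sums over factorizations *)

Section DivisorSums.

Variables (F : finFieldType) (A : nmodType).

Lemma size_sub_monic (p : {poly F}) m : p \is monic -> size p = m.+1 ->
  (size (p - 'X^m)%R <= m)%N.
Proof.
move=> /monicP p1 sp; apply/leq_sizeP => j;
  rewrite leq_eqVlt => /orP[/eqP<-|mj].
  by rewrite coefB coefXn eqxx; move: p1; rewrite lead_coefE sp => ->;
    rewrite subrr.
by rewrite coefB coefXn gtn_eqF // subr0 nth_default // sp.
Qed.

(** Division by the monic h is a bijection from its monic multiples of degree k to the monic
    polynomials of degree k - i. It is expressed on lower-order terms, whence the subtracted powers
    of ['X]. *)
Lemma big_monic_dvd (h : {poly F}) (k i : nat) (G : {poly F} -> A) :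
  h \is monic -> size h = i.+1 -> (i <= k)%N ->
  \sum_(r : {poly_k F} | h %| 'X^k + polyn r) G ('X^k + polyn r) =
  \sum_(s : {poly_(k - i) F}) G (h * ('X^(k - i) + polyn s)).
Proof.
move=> h_mon sh ik; have h0 := monic_neq0 h_mon.
have hE (s : {poly_(k - i) F}) :
    polyn (npolyp k (h * ('X^(k - i) + polyn s) - 'X^k)) =
    h * ('X^(k - i) + polyn s) - 'X^k.
  rewrite npolypK //; apply: size_sub_monic;
    first by rewrite monicMl ?monic_addXn.
  by rewrite size_Mmonic ?monic_addXn ?monic_neq0 // size_addXn sh addSn /=
    addnS subnKC.
rewrite (reindex_onto
  (fun s : {poly_(k - i) F} => npolyp k (h * ('X^(k - i) + polyn s) - 'X^k))
  (fun r => npolyp (k - i) (('X^k + polyn r) %/ h - 'X^(k - i)))) /=.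
  apply: eq_big => [s|s _]; last by rewrite hE addrC subrK.
  rewrite hE [_ + (_ - _)]addrC subrK dvdp_mulr // mulrC mulpK //.
  by apply/eqP/val_inj; rewrite /= addrAC subrr add0r npolypK // size_npoly.
move=> r hr; apply/val_inj; rewrite /= hE npolypK.
  by rewrite [_ + (_ - _)]addrC subrK mulrC divpK // addrAC subrr add0r.
have dE : ('X^k + polyn r) %/ h * h = 'X^k + polyn r by rewrite divpK.
apply: size_sub_monic.
  by rewrite -(monicMr _ h_mon) dE monic_addXn.
by rewrite size_divp // size_addXn sh /= subSn.
Qed.

Lemma num_divisorsE (m : nat) (f : {poly F}) : size f = m ->
  num_divisors f =
    (\sum_(h : {poly_m F} | polyn h \is monic) ((polyn h %| f)%R : nat))%N.
Proof.
move=> <-; rewrite /num_divisors -sum1_card big_mkcond [RHS]big_mkcond /=.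
by apply: eq_bigr => h _; rewrite inE; case: (_ \is monic); case: (_ %| _).
Qed.

(** Expand d(f) as a sum over monic divisors, exchange the sums, and sort by the degree i of the
    divisor; the cofactor is monic of degree k - i. *)
Lemma sum_num_divisors (k : nat) (G : {poly F} -> A) :
  \sum_(r : {poly_k F}) G ('X^k + polyn r) *+ num_divisors ('X^k + polyn r) =
  \sum_(i < k.+1) \sum_(r : {poly_i F}) \sum_(s : {poly_(k - i) F})
    G (('X^i + polyn r) * ('X^(k - i) + polyn s)).
Proof.
transitivity (\sum_(h : {poly_k.+1 F} | polyn h \is monic)
    \sum_(r : {poly_k F} | polyn h %| 'X^k + polyn r) G ('X^k + polyn r)).
  rewrite [RHS](exchange_big_dep xpredT) //=; apply: eq_bigr => r _.
  rewrite (num_divisorsE (size_addXn r)) -sumrMnr big_mkcondr /=.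
  by apply: eq_bigr => h _; case: (_ %| _).
rewrite (big_monic k.+1 (fun h =>
  \sum_(r : {poly_k F} | h %| 'X^k + polyn r) G ('X^k + polyn r))).
apply: eq_bigr => i _; apply: eq_bigr => r _.
by rewrite (big_monic_dvd _ (monic_addXn r) (size_addXn r)) // -ltnS.
Qed.

End DivisorSums.

(** * Coefficients and partial sums of the Estermann series *)

Section Coefficients.

Variables (R : realType) (F : finFieldType) (g : {poly F}) (n : nat).
Hypotheses (g_monic : g \is monic) (size_g : size g = n.+1) (n_gt0 : (0 < n)%N).
Variable c : {poly F}.
Hypothesis c_g : coprimep c g.

Local Notation q := (#|F|%:R : R[i]).
Local Notation psi := (psi R g).

(** The contribution of the factorizations ab with deg a = i and deg b = j. *)
Definition psi_sum (i j : nat) : R[i] :=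
  \sum_(r : {poly_i F}) \sum_(s : {poly_j F})
    psi (c * (('X^i + polyn r) * ('X^j + polyn s))).

Lemma psi_sumC i j : psi_sum i j = psi_sum j i.
Proof.
rewrite /psi_sum exchange_big; apply: eq_bigr => s _; apply: eq_bigr => r _.
by rewrite [X in c * X]mulrC.
Qed.

(** Summing over the factor of degree i >= n leaves q^i if g divides the other factor, c being
    coprime to g, and 0 otherwise. There are q^(j-n) monic multiples of g of degree j >= n, and none
    of smaller degree. *)
Lemma psi_sum_large i j : (n <= i)%N ->
  psi_sum i j = (n <= j)%:R * q ^+ (i + j - n).
Proof.
move=> ni; rewrite psi_sumC.
transitivity (\sum_(s : {poly_j F} | g %| 'X^j + polyn s) q ^+ i).
  rewrite [RHS]big_mkcond; apply: eq_bigr => s _.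
  under eq_bigr => r _ do rewrite mulrA.
  rewrite (sum_psi_large R g_monic size_g n_gt0) // Gauss_dvdpr 1?coprimep_sym
    //.
  by case: ifP; rewrite ?mul1r ?mul0r.
have [nj|jn] := leqP n j; last first.
  rewrite mul0r big_pred0 // => s; apply/negP => /dvdp_leq.
  by rewrite monic_neq0 ?monic_addXn // size_addXn size_g ltnS leqNgt jn => /(_
    isT).
rewrite (big_monic_dvd (fun=> q ^+ i) g_monic size_g nj) sumr_const card_npoly.
by rewrite mul1r -addnBA // exprD -[LHS]mulr_natr natrX.
Qed.

Lemma sum_estermann_term k u :
  \sum_(r : {poly_k F}) estermann_term c g u ('X^k + polyn r) =
  u ^+ k * \sum_(i < k.+1) psi_sum i (k - i).
Proof.
rewrite big_distrr /= /psi_sum.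
transitivity (\sum_(r : {poly_k F})
  (u ^+ k * psi (c * ('X^k + polyn r))) *+ num_divisors ('X^k + polyn r)).
  apply: eq_bigr => r _; rewrite /estermann_term monic_addXn size_addXn /=.
  by rewrite -/(psi _) -mulr_natl; ring.
rewrite (sum_num_divisors k (fun f => u ^+ k * psi (c * f))).
by apply: eq_bigr => i _; rewrite big_distrr; apply: eq_bigr => r _;
  rewrite big_distrr.
Qed.

(** There are (k + 1) q^k pairs of monic polynomials whose degrees add up to k. This gives absolute
    convergence for |u| < 1/q. *)
Lemma sum_norm_estermann_term k u :
  \sum_(r : {poly_k F}) `|estermann_term c g u ('X^k + polyn r)| =
  k.+1%:R * (q * `|u|) ^+ k.
Proof.
transitivity (\sum_(r : {poly_k F}) (`|u| ^+ k) *+ num_divisors ('X^k + polyn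
  r)).
  apply: eq_bigr => r _; rewrite /estermann_term monic_addXn size_addXn /=.
  by rewrite -/(psi _) !normrM normr_nat normrX norm_psi mulr1 mulr_natl.
rewrite (sum_num_divisors k (fun=> `|u| ^+ k)).
transitivity (\sum_(i < k.+1) (q * `|u|) ^+ k).
  apply: eq_bigr => i _; rewrite !sumr_const !card_npoly -mulrnA -expnD.
  by rewrite subnK -1?ltnS // exprMn -[LHS]mulr_natl natrX.
by rewrite sumr_const card_ord [RHS]mulr_natl.
Qed.

Lemma estermann_finE u : estermann_fin g n c u =
  \sum_(i < n) \sum_(j < n) u ^+ (i + j) * psi_sum i j.
Proof.
rewrite estermann_fin_monic (big_monic n (fun a =>
  \sum_(b : {poly_n F} | polyn b \is monic)
    mon u a * mon u (polyn b) * psi (c * (a * polyn b)))).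
apply: eq_bigr => i _.
under eq_bigr => r _ do rewrite (big_monic n (fun b =>
  mon u ('X^i + polyn r) * mon u b * psi (c * (('X^i + polyn r) * b)))).
rewrite exchange_big; apply: eq_bigr => j _ /=.
rewrite big_distrr; apply: eq_bigr => r _; rewrite big_distrr;
  apply: eq_bigr => s _.
by rewrite /mon !monic_addXn !size_addXn exprD.
Qed.

(** The indices counted are n <= i <= k - n; truncated subtraction gives the correct count 0 when k
    < 2n. *)
Lemma sum_window k :
  (\sum_(i < k.+1) ((n <= i) && (n <= k - i)) = k.+1 - n * 2)%N.
Proof.
have [kn|kn] := ltnP k (n * 2).
  rewrite big1 => [|i _]; first by lia.
  by case: leqP => //= ni; case: leqP => //= nk; have := ltn_ord i; lia.
have [l ->] : exists l, k = (n * 2 + l)%N by exists (k - n * 2)%N; lia.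
rewrite -(big_mkord xpredT (fun i : nat => nat_of_bool ((n <= i) && (n <= n * 2
  + l - i)))%N).
rewrite (@big_cat_nat _ _ _ n) /=; [|lia..].
rewrite (@big_cat_nat _ _ _ (n + l.+1)%N n) /=; [|lia..].
rewrite big_nat_cond big1 => [|i]; last by case: leqP => //=; lia.
rewrite (eq_big_nat _ _ (F2 := fun=> 1%N)) => [|i /andP[ni il]]; last first.
  by rewrite ni /=; have -> : (n <= n * 2 + l - i)%N by lia.
rewrite sum_nat_const_nat [X in (_ + (_ + X))%N]big_nat_cond big1 => [|i];
  first lia.
by rewrite andbT => /andP[il ik]; case: (leqP n (_ - _)) => // ;
  rewrite ?andbF //; lia.
Qed.

(** The pairs of degrees (i, j) with both below n give P_c, those with both at least n give
    q^(i+j-n), and mixed pairs cancel. Starting at 2n terms ensures that the first block is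
    complete. *)
Lemma sum_estermann_terms u m :
  \sum_(k < n * 2 + m) \sum_(r : {poly_k F}) estermann_term c g u ('X^k + polyn
    r) =
  estermann_fin g n c u +
  q ^+ n * u ^+ (n * 2) * \sum_(k < m) k.+1%:R * (q * u) ^+ k.
Proof.
pose lo i j := (i < n)%N && (j < n)%N.
have psiE i j : psi_sum i j = (lo i j)%:R * psi_sum i j +
    ((n <= i)%N && (n <= j)%N)%:R * q ^+ (i + j - n).
  rewrite /lo; have [ni|ni] := leqP n i; first by rewrite psi_sum_large //=
    mul0r add0r.
  have [nj|nj] := leqP n j; last by rewrite mul1r mul0r addr0.
  by rewrite psi_sumC psi_sum_large // leqNgt ni !mul0r addr0.
under eq_bigr => k _ do rewrite sum_estermann_term.
under eq_bigr => k _ do under eq_bigr => i _ do rewrite psiE.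
under eq_bigr => k _ do rewrite big_split mulrDr.
rewrite big_split /=; congr (_ + _).
  transitivity (\sum_(k < n * 2 + m) \sum_(i < k.+1)
    (fun i j => (lo i j)%:R * (u ^+ (i + j) * psi_sum i j)) i (k - i)%N).
    apply: eq_bigr => k _; rewrite big_distrr; apply: eq_bigr => i _ /=.
    by rewrite subnKC -1?ltnS // mulrCA.
  (* The square i, j < n lies inside the triangle i + j < 2n + m. *)
  rewrite (big_triangle (n * 2 + m)
    (fun i j => (lo i j)%:R * (u ^+ (i + j) * psi_sum i j))) estermann_finE.
  rewrite -(@big_ord_indic _ (n * 2 + m) n
    (fun i => \sum_(j < n) u ^+ (i + j) * psi_sum i j)); last by lia.
  apply: eq_bigr => i _; rewrite /lo; case: ltnP => ni; last first.
    by rewrite mul0r big1 // => j _; rewrite mul0r.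
  rewrite mul1r -(@big_ord_indic _ (n * 2 + m - i) n
    (fun j => u ^+ (i + j) * psi_sum i j)) //; lia.
transitivity (\sum_(k < n * 2 + m)
    (k.+1 - n * 2)%N%:R * (u ^+ k * q ^+ (k - n))).
  apply: eq_bigr => k _; rewrite -sum_window natr_sum !big_distrl big_distrr.
  by apply: eq_bigr => i _ /=; rewrite subnKC -1?ltnS // mulrCA.
rewrite big_split_ord /= big1 ?add0r => [|k _]; last first.
  by have -> : (k.+1 - n * 2)%N = 0%N; [have := ltn_ord k; lia | rewrite mul0r].
rewrite big_distrr; apply: eq_bigr => k _ /=.
have -> : ((n * 2 + k).+1 - n * 2)%N = k.+1 by lia.
have -> : (n * 2 + k - n)%N = (n + k)%N by lia.
by rewrite exprMn !exprD; ring.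
Qed.

End Coefficients.

(** * Power series and meromorphic functions *)

Section Balls.

Local Open Scope classical_set_scope.

Variable C : numFieldType.
Implicit Types (z w : C) (P : C -> Prop).

Lemma near_ballP z P : (\forall w \near z, P w) <->
  exists2 e : C, 0 < e & forall w, `|w - z| < e -> P w.
Proof.
split=> [/nbhs_normP[e /= e0 he]|[e e0 he]].
  by exists e => // w wz; apply: he; rewrite /= distrC.
by apply/nbhs_normP; exists e => //= w wz; apply: he; rewrite distrC.
Qed.

Lemma dnear_ballP z P : (\forall w \near z^', P w) <->
  exists2 e : C, 0 < e & forall w, w != z -> `|w - z| < e -> P w.
Proof.
split=> [/near_ballP[e e0 he]|[e e0 he]].
  by exists e => // w wz we; apply: he.
by apply/near_ballP; exists e => // w we wz; apply: he.
Qed.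

Lemma fun_cvgP (f : C -> C) z (l : C) : f @ z --> l <->
  forall e : C, 0 < e -> exists2 d : C, 0 < d &
    forall w, `|w - z| < d -> `|f w - l| < e.
Proof.
split=> [/(@cvgrPdist_lt _ C _ (nbhs z)) h e /h /near_ballP[d d0 hd]|h].
  by exists d => // w wd; rewrite distrC; apply: hd.
apply/(@cvgrPdist_lt _ C _ (nbhs z)) => e /h [d d0 hd].
by apply/near_ballP; exists d => // w wd; rewrite distrC; apply: hd.
Qed.

Lemma seq_cvgP (u : nat -> C) (l : C) : u @ \oo --> l <->
  forall e : C, 0 < e -> exists N, forall n, (N <= n)%N -> `|u n - l| < e.
Proof.
split=> [/cvgrPdist_lt h e /h [N _ hN]|h].
  by exists N => n Nn; rewrite distrC; apply: hN.
apply/cvgrPdist_lt => e /h [N hN].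
by exists N => // n Nn /=; rewrite distrC; apply: hN.
Qed.

Lemma dnear_neq z (a : C) : \forall w \near z^', w != a.
Proof.
apply/dnear_ballP; have [->|za] := eqVneq z a; first by exists 1.
exists `|z - a|; first by rewrite normr_gt0 subr_eq0.
by move=> w wz; apply: contraTneq => ->; rewrite distrC ltxx.
Qed.

End Balls.

(** * Local theory of analytic and meromorphic functions *)

Section PowerSeries.

Local Open Scope classical_set_scope.

Variable C : numFieldType.
Implicit Types (a : nat -> C) (z w s l : C).

Lemma cvg_seq0_bound (u : nat -> C) : u @ \oo --> (0 : C) ->
  exists2 B : C, 0 <= B & forall k, `|u k| <= B.
Proof.
move=> /seq_cvgP/(_ 1 ltr01)[N hN].
have sum_ge0 : 0 <= \sum_(k < N) `|u k| by apply: sumr_ge0.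
exists (1 + \sum_(k < N) `|u k|); first by rewrite addr_ge0.
move=> k; have [kN|Nk] := ltnP k N.
  rewrite (bigD1 (Ordinal kN)) //= addrCA lerDl addr_ge0 //.
  by apply: sumr_ge0.
by have := ltW (hN _ Nk); rewrite subr0 => /le_trans; apply; rewrite lerDl.
Qed.

Lemma geometric_tail (x : C) m n : 0 <= x -> x <= 1 / 2 ->
  \sum_(m <= k < n) x ^+ k <= 2 * x ^+ m.
Proof.
move=> x0 x2; have [nm|mn] := leqP n m.
  by rewrite big_geq // mulr_ge0 // exprn_ge0.
rewrite -{1}[m]add0n big_addn -{1}(subnK (ltnW mn)) addnK.
rewrite (eq_bigr (fun i => x ^+ m * x ^+ i)) => [|i _];
  last by rewrite exprD mulrC.
rewrite -big_distrr /= [2 * _]mulrC ler_wpM2l ?exprn_ge0 // big_mkord.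
have x1 : x < 1 by apply: le_lt_trans x2 _; rewrite ltr_pdivrMr // mul1r ltr1n.
have x1' : 0 < 1 - x by rewrite subr_gt0.
have := subrX1 x (n - m) => e.
have -> : \sum_(i < n - m) x ^+ i = (1 - x ^+ (n - m)) / (1 - x).
  apply: (canRL (mulfK _)); first by rewrite gt_eqF.
  by rewrite mulrC -[1 - x ^+ _]opprB e -mulNr opprB.
rewrite ler_pdivrMr // (le_trans (y := 1)) // ?lerBlDr ?lerDl ?exprn_ge0 //.
rewrite mulrBr mulr1 lerBrDr -lerBrDl.
by apply: le_trans (ler_wpM2l _ x2) _ => //;
  rewrite mul1r mulfV ?pnatr_eq0 // -[2]/(1 + 1) addrK.
Qed.

(* Cauchy's estimate at the point [r], followed by a geometric tail. *)
Lemma power_series_tail a (r : C) : r != 0 ->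
  (fun k => a k * r ^+ k) @ \oo --> (0 : C) ->
  exists2 B : C, 0 <= B & forall m s l, (forall k, (k < m)%N -> a k = 0) ->
    `|s| <= `|r| / 2 ->
    series (fun k => a k * s ^+ k) @ \oo --> l ->
    `|l - a m * s ^+ m| <= B * (`|s| / `|r|) ^+ m.+1.
Proof.
move=> r0 /cvg_seq0_bound[B B0 hB]; exists (B * 2); first by rewrite mulr_ge0.
move=> m s l am sr sl; have nr0 : 0 < `|r| by rewrite normr_gt0.
set x := `|s| / `|r|; have x0 : 0 <= x by rewrite divr_ge0.
have x2 : x <= 1 / 2 by rewrite ler_pdivrMr // mul1r mulrC.
have hS n : (m < n)%N -> `|series (fun k => a k * s ^+ k) n - a m * s ^+ m| <=
  B * 2 * x ^+ m.+1.
  move=> mn; rewrite /series /= (@big_cat_nat _ _ _ m) //=; last exact: ltnW.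
  rewrite big_nat_cond big1 => [|i]; last by rewrite andbT => /am ->;
    rewrite mul0r.
  rewrite add0r big_ltn // addrAC subrr add0r -mulrA.
  apply: le_trans (ler_wpM2l B0 (geometric_tail m.+1 n x0 x2)).
  rewrite big_distrr /=; apply: le_trans (ler_norm_sum _ _ _) _.
  apply: ler_sum => k _; rewrite normrM normrX /x expr_div_n mulrA.
  rewrite ler_pdivlMr ?exprn_gt0 // mulrAC ler_wpM2r ?exprn_ge0 //.
  by rewrite -normrX -normrM.
apply/ler_addgt0Pr => e e0; have /seq_cvgP/(_ e e0)[N hN] := sl.
pose n := maxn N m.+1.
apply: le_trans (ler_distD (series (fun k => a k * s ^+ k) n) _ _) _.
by rewrite addrC lerD ?hS ?leq_maxr // distrC ltW // hN // leq_maxl.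
Qed.

(** Packages what the local theory uses: if the coefficients below m vanish, f differs from its m-th
    term by O(|w - z|^(m+1)), with r and B independent of m. *)
Lemma analytic_expansion (f : C -> C) z : analytic_at f z ->
  exists2 a, f z = a 0%N & exists r B : C, [/\ 0 < r, 0 <= B,
    forall m w, (forall k, (k < m)%N -> a k = 0) -> `|w - z| <= r / 2 ->
    `|f w - a m * (w - z) ^+ m| <= B * (`|w - z| / r) ^+ m.+1 &
    forall w, (forall k, a k = 0) -> `|w - z| <= r / 2 -> f w = 0].
Proof.
move=> [a /near_ballP[e e0 he]]; exists a.
  have := he z; rewrite subrr normr0 => /(_ e0) h0.
  apply: (@cvg_unique C _ (series (fun k => a k * 0 ^+ k) @ \oo)) => //.
  rewrite /= -cvg_shiftS /=.
  apply: cvg_trans (@cvg_cst _ (a 0%N) nat \oo _).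
  apply: near_eq_cvg; near=> n; rewrite /series /= big_nat_recl //=.
  by rewrite expr0 mulr1 big1 ?addr0 // => i _; rewrite expr0n mulr0.
have he2 : `|e / 2| < e.
  by rewrite gtr0_norm ?divr_gt0 // ltr_pdivrMr // ltr_pMr // ltr1n.
have e20 : e / 2 != 0 by rewrite gt_eqF // divr_gt0.
(* The series converges at z + e/2, inside the ball of radius e, so its terms tend to 0 there; this
   feeds the tail estimate. *)
have : (fun k => a k * (e / 2) ^+ k) @ \oo --> (0 : C).
  apply: cvg_series_cvg_0; apply/cvg_ex; exists (f (z + e / 2)).
  by have := he (z + e / 2); rewrite [z + _]addrC addrK; apply.
move=> /(power_series_tail e20)[B B0 hB]; exists (e / 2), B.
have e2E : `|e / 2| = e / 2 by rewrite gtr0_norm ?divr_gt0.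
rewrite e2E in hB; have hr w : `|w - z| <= e / 2 / 2 -> `|w - z| < e.
  move=> /le_lt_trans; apply; rewrite -mulrA gtr_pMr // -invfM invf_lt1
    ?mulr_gt0 //.
  by rewrite -natrM ltr1n.
split=> [||m w am wz|w a0 /hr /he hw]; rewrite ?divr_gt0 //.
  by apply: hB => //; apply/he/hr.
apply: (@cvg_unique C _ _ _ _ _ hw) => //.
apply: cvg_trans (@cvg_cst _ (0 : C) nat \oo _).
apply: near_eq_cvg; near=> n; rewrite /series /= big1 // => i _.
by rewrite a0 mul0r.
Unshelve. all: by end_near. Qed.

Lemma analytic_continuous (f : C -> C) z : analytic_at f z -> f @ z --> f z.
Proof.
move=> /analytic_expansion[a fz [r [B [r0 B0 hB hB0]]]].
apply/fun_cvgP => e e0; have B1 : 0 < B + 1 by rewrite ltr_wpDl.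
suff /near_ballP[d d0 hd] : \forall w \near z, `|f w - f z| < e by exists d.
near=> w.
have wz : `|w - z| <= r / 2.
  rewrite ltW //; near: w; apply/near_ballP; exists (r / 2) => //.
  by rewrite divr_gt0.
have we : `|w - z| < e * r / (B + 1).
  near: w; apply/near_ballP; exists (e * r / (B + 1)) => //.
  by rewrite divr_gt0 ?mulr_gt0.
(* For m = 0 the condition on lower coefficients is vacuous, and the estimate bounds |f w - f z| by
   B |w - z| / r. *)
have := hB 0%N w (fun k h => False_ind _ (Bool.diff_false_true h)) wz.
rewrite expr0 mulr1 -fz expr1 => /le_lt_trans; apply.
apply: (@le_lt_trans _ _ ((B + 1) * (`|w - z| / r))).
  by rewrite ler_wpM2r ?lerDl // divr_ge0 // ltW.
by rewrite mulrA ltr_pdivrMr // mulrC -ltr_pdivlMr.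
Unshelve. all: by end_near. Qed.

(** If some coefficient is nonzero, the first such term a_k (w - z)^k dominates the remainder close
    to z. *)
Lemma analytic_dichotomy (f : C -> C) z : analytic_at f z ->
  (\forall w \near z^', f w = 0) \/ (\forall w \near z^', f w != 0).
Proof.
move=> fz; have /analytic_expansion[a _ [r [B [r0 B0 hB hB0]]]] := fz.
have [[m am]|a0] := pselect (exists m, a m != 0); last first.
  have {}a0 m : a m = 0 by apply/eqP; apply: contra_notT a0 => am; exists m.
  left; apply: cvg_within; apply/near_ballP; exists (r / 2);
    first by rewrite divr_gt0.
  by move=> w /ltW wz; apply: hB0.
have [k ak kmin] := ex_minnP (ex_intro (fun m => a m != 0) m am).
have {}kmin j : (j < k)%N -> a j = 0.
  by move=> jk; apply/eqP; apply: contraTT jk => /kmin; rewrite leqNgt.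
right; have B1 : 0 < B + 1 by rewrite ltr_wpDl.
near=> w.
have wz : w != z by near: w; exact: dnear_neq.
have wr : `|w - z| <= r / 2.
  rewrite ltW //; near: w; apply/dnear_ballP; exists (r / 2) => //.
  by rewrite divr_gt0.
have := hB k w kmin wr; apply: contraTneq => ->.
have s0 : 0 < `|w - z| by rewrite normr_gt0 subr_eq0.
rewrite sub0r normrN normrM normrX expr_div_n exprS mulrA ler_pdivlMr
  ?exprn_gt0 //.
(* This radius makes B (|w - z| / r)^(k+1) smaller than |a_k| |w - z|^k; B + 1 keeps the divisor
   positive. *)
have we : `|w - z| < `|a k| * r ^+ k.+1 / (B + 1).
  near: w; apply/dnear_ballP; exists (`|a k| * r ^+ k.+1 / (B + 1)) => //.
  by rewrite divr_gt0 ?mulr_gt0 ?exprn_gt0 ?normr_gt0.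
rewrite mulrAC mulrA ler_pM2r ?exprn_gt0 //; apply/negP => h.
have : `|a k| * r ^+ k.+1 < `|a k| * r ^+ k.+1; last by rewrite ltxx.
apply: le_lt_trans h _; apply: le_lt_trans (_ : (B + 1) * `|w - z| < _).
  by rewrite ler_wpM2r // lerDl.
by rewrite mulrC -ltr_pdivlMr.
Unshelve. all: by end_near. Qed.

Lemma analytic_at_cst b z : analytic_at (fun=> b) z.
Proof.
exists (fun k => if k is 0%N then b else 0); near=> w.
rewrite /= -cvg_shiftS /=.
apply: cvg_trans (@cvg_cst _ b nat \oo _).
apply: near_eq_cvg; near=> n; rewrite /series /= big_nat_recl //=.
by rewrite expr0 mulr1 big1 ?addr0 // => i _; rewrite mul0r.
Unshelve. all: by end_near. Qed.

Lemma analytic_at_add (f h : C -> C) z :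
  analytic_at f z -> analytic_at h z -> analytic_at (fun w => f w + h w) z.
Proof.
move=> [a ha] [b hb]; exists (fun k => a k + b k); near=> w.
rewrite (_ : (fun k => _) = (fun k => a k * (w - z) ^+ k) + (fun k => b k * (w
  - z) ^+ k)).
  by rewrite seriesD; apply: cvgD; near: w.
by apply/funext => k /=; rewrite mulrDl.
Unshelve. all: by end_near. Qed.

Lemma analytic_at_scale (f : C -> C) b z :
  analytic_at f z -> analytic_at (fun w => b * f w) z.
Proof.
move=> [a ha]; exists (fun k => b * a k); near=> w.
rewrite (_ : series _ = (fun n => b * series (fun k => a k * (w - z) ^+ k) n)).
  by apply: cvgMr; near: w.
by apply/funext => n; rewrite /series /= big_distrr; apply: eq_bigr => k _ /=;
  rewrite mulrA.
Unshelve. all: by end_near. Qed.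

Lemma analytic_at_mulB (f : C -> C) z :
  analytic_at f z -> analytic_at (fun w => (w - z) * f w) z.
Proof.
move=> [a ha]; exists (fun k => if k is k'.+1 then a k' else 0); near=> w.
rewrite /= -cvg_shiftS /=.
rewrite (_ : (fun n => _) = (fun n => (w - z) * series (fun k => a k * (w - z)
  ^+ k) n)).
  by apply: cvgMr; near: w.
apply/funext => n; rewrite /series /= big_nat_recl //= mul0r add0r big_distrr.
by apply: eq_bigr => k _ /=; rewrite exprS mulrCA.
Unshelve. all: by end_near. Qed.

(** Horner's scheme with w = (w - z) + z: multiplication by w - z shifts the coefficients,
    multiplication by z scales them. *)
Lemma analytic_at_horner (f : C -> C) (p : {poly C}) z :
  analytic_at f z -> analytic_at (fun w => f w * p.[w]) z.
Proof.
move=> hf; elim/poly_ind: p => [|p b IH].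
  have -> : (fun w => f w * 0.[w]) = (fun=> 0).
    by apply/funext => w; rewrite horner0 mulr0.
  exact: analytic_at_cst.
have -> : (fun w => f w * (p * 'X + b%:P).[w]) =
    (fun w => ((w - z) * (f w * p.[w]) + z * (f w * p.[w])) + b * f w).
  by apply/funext => w; rewrite hornerMXaddC; ring.
apply: analytic_at_add; last exact: analytic_at_scale.
by apply: analytic_at_add; [exact: analytic_at_mulB | exact: analytic_at_scale].
Qed.

Lemma analytic_zero_at (f : C -> C) z : analytic_at f z ->
  (\forall w \near z^', f w = 0) -> f z = 0.
Proof.
move=> /analytic_continuous/fun_cvgP fz f0; apply/eqP; apply: contraT => fz0.
have [|d d0 hd] := fz `|f z|; first by rewrite normr_gt0.
have [w [fw]] : exists w, f w = 0 /\ `|w - z| < d.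
  apply: (@filter_ex _ z^'); near=> w; split; first by near: w.
  by near: w; apply/dnear_ballP; exists d.
by move/hd; rewrite fw sub0r normrN ltxx.
Unshelve. all: by end_near. Qed.

Lemma analytic_at_horner0 (p : {poly C}) z : analytic_at (fun w => p.[w]) z.
Proof.
have := analytic_at_horner p (analytic_at_cst 1 z); congr analytic_at.
by apply/funext => w; rewrite mul1r.
Qed.

Lemma analytic_at_sub (f h : C -> C) z :
  analytic_at f z -> analytic_at h z -> analytic_at (fun w => f w - h w) z.
Proof.
move=> fz hz; have := analytic_at_add fz (analytic_at_scale (-1) hz).
by congr analytic_at; apply/funext => w; rewrite mulN1r.
Qed.

Lemma analytic_at_subX (f : C -> C) m z :
  analytic_at f z -> analytic_at (fun w => f w * (w - z) ^+ m) z.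
Proof.
move=> fz; have := analytic_at_horner (('X - z%:P) ^+ m) fz; congr analytic_at.
by apply/funext => w; rewrite horner_exp hornerXsubC.
Qed.

Lemma meromorphic_local (f : C -> C) z : meromorphic f ->
  exists m h, analytic_at h z /\ \forall w \near z^', f w * (w - z) ^+ m = h w.
Proof.
move=> /(_ z)[fz|[m [h [_ hz _ fh]]]].
  by exists 0%N, f; split=> //; near=> w; rewrite mulr1.
exists m, h; split=> //; near=> w.
have wz : w != z by near: w; exact: dnear_neq.
have -> : f w = h w / (w - z) ^+ m by near: w.
by rewrite divfK // expf_neq0 // subr_eq0.
Unshelve. all: by end_near. Qed.

(** Clearing the pole, (f r - p)(w - z)^m is analytic at z, and the power of w - z has no zero off
    z. The rational function p / r is compared with f without division. *)
Lemma meromorphic_dichotomy (f : C -> C) (p r : {poly C}) z : meromorphic f ->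
  (\forall w \near z^', f w * r.[w] = p.[w]) \/
  (\forall w \near z^', f w * r.[w] != p.[w]).
Proof.
move=> /(meromorphic_local z)[m [h [hz fh]]].
have key : \forall w \near z^',
    h w * r.[w] - p.[w] * (w - z) ^+ m = (f w * r.[w] - p.[w]) * (w - z) ^+ m.
  near=> w; have <- : f w * (w - z) ^+ m = h w by near: w.
  by ring.
have nz : \forall w \near z^', (w - z) ^+ m != 0.
  near=> w; rewrite expf_neq0 // subr_eq0; near: w; exact: dnear_neq.
have := analytic_dichotomy (analytic_at_sub (analytic_at_horner r hz)
  (analytic_at_subX m (analytic_at_horner0 p z))).
case=> h0; [left|right]; near=> w.
  have wz : (w - z) ^+ m != 0 by near: w.
  apply/eqP; rewrite -subr_eq0 -(mulIr_eq0 _ (mulIf wz)); apply/eqP.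
  rewrite -(near key w) //.
  by near: w.
have wz : (w - z) ^+ m != 0 by near: w.
rewrite -subr_eq0 -(mulIr_eq0 _ (mulIf wz)) -(near key w) //.
by near: w.
Unshelve. all: by end_near. Qed.

(** A pole is impossible: its numerator would agree with h(w) (w - z)^m near z and so vanish at z.
    Hence f is analytic at z, and continuity fixes the value there. *)
Lemma meromorphic_eq_at (f h : C -> C) z : meromorphic f -> analytic_at h z ->
  (\forall w \near z^', f w = h w) -> f z = h z.
Proof.
move=> /(_ z)[fz|[m [k [m0 kz kz0 fk]]]] hz fh.
  apply/eqP; rewrite -subr_eq0; apply/eqP.
  apply: (analytic_zero_at (analytic_at_sub fz hz)).
  by near=> w; apply/eqP; rewrite subr_eq0; apply/eqP; near: w.
case/eqP: kz0.
have := analytic_zero_at (analytic_at_sub kz (analytic_at_subX m hz)).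
rewrite subrr expr0n gtn_eqF // mulr0 subr0; apply.
near=> w; have wz : w != z by near: w; exact: dnear_neq.
have <- : f w = h w by near: w.
have -> : f w = k w / (w - z) ^+ m by near: w.
by rewrite divfK ?subrr // expf_neq0 // subr_eq0.
Unshelve. all: by end_near. Qed.

(** A small enough ball around a nearby point v != z, punctured at v, stays inside the ball around z
    and avoids z. This yields openness in the identity principle. *)
Lemma dnear_shift z (P : C -> Prop) : (\forall w \near z^', P w) ->
  \forall v \near z, \forall w \near v^', P w.
Proof.
move=> zP; have /dnear_ballP[e e0 he] := zP.
apply/near_ballP; exists e => // v vz; have [->//|vz'] := eqVneq v z.
near=> w; apply: he; first by near: w; exact: dnear_neq.
near: w; apply/dnear_ballP; exists (e - `|v - z|); first by rewrite subr_gt0.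
by move=> w _ wv; rewrite (le_lt_trans (ler_distD v _ _)) // -ltrBrDr.
Unshelve. all: by end_near. Qed.

Lemma sum_succ_mul_expr (x : C) m :
  (1 - x) ^+ 2 * \sum_(k < m) k.+1%:R * x ^+ k =
  1 - m.+1%:R * x ^+ m + m%:R * x ^+ m.+1.
Proof.
elim: m => [|m IH]; first by rewrite big_ord0 mulr0 mul0r addr0 mulr1 subrr.
rewrite big_ord_recr /= mulrDr IH !exprS -!natr1; ring.
Qed.

End PowerSeries.

(** * Complex power series and the identity principle *)

Section ComplexSeries.

Local Open Scope classical_set_scope.

Variable R : realType.
Local Notation C := R[i].

(** The partial sums increase and are bounded by (1 - t)^-2, so the series converges and its terms
    tend to 0. *)
Lemma succ_mul_expr_cvg0 (t : R) : 0 <= t -> t < 1 ->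
  (fun k => k.+1%:R * t ^+ k) @ \oo --> (0 : R).
Proof.
move=> t0 t1; apply: cvg_series_cvg_0; apply: nondecreasing_is_cvgn.
  apply/nondecreasing_seqP => n; rewrite /series /= big_nat_recr //= lerDl.
  by rewrite mulr_ge0 // exprn_ge0.
exists ((1 - t) ^- 2) => _ [m _ <-].
rewrite /series /= big_mkord -[leRHS]mul1r ler_pdivlMr ?exprn_gt0 ?subr_gt0 //.
rewrite mulrC sum_succ_mul_expr -addrA gerDl addrC subr_le0 exprSr.
rewrite [t ^+ m * t]mulrC mulrA ler_wpM2r ?exprn_ge0 //.
by rewrite (le_trans (ler_wpM2l _ (ltW t1))) // mulr1 ler_nat.
Qed.

Lemma complex_gt0 (e : C) : 0 < e -> exists2 d : R, 0 < d & e = d%:C%C.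
Proof.
by case: e => a b; rewrite ltcE /= => /andP[/eqP-> a0]; exists a.
Qed.

Lemma norm_complexE (x : C) : `|x| = (complex.Re `|x|)%:C%C.
Proof. by rewrite normc_def. Qed.

(** By [sum_succ_mul_expr], the error after m terms times (1 - x)^2 has norm at most 2 (m + 1)
    |x|^m, which is controlled by a real sequence tending to 0. *)
Lemma geometric_square_cvg (x : C) : `|x| < 1 ->
  series (fun k => k.+1%:R * x ^+ k) @ \oo --> ((1 - x) ^- 2 : (C :
    numFieldType)).
Proof.
move=> x1; have x1' : 1 - x != 0.
  by rewrite subr_eq0; apply: contraTneq x1 => <-; rewrite normr1 ltxx.
pose t := complex.Re `|x|; have xt : `|x| = t%:C%C by rewrite norm_complexE.
have t0 : 0 <= t by rewrite -lecR -xt; exact: normr_ge0.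
have t1 : t < 1 by rewrite -ltcR -xt; exact: x1.
apply/seq_cvgP => e e0.
have b0 : 0 < `|1 - x| ^+ 2 by rewrite exprn_gt0 ?normr_gt0.
have [d d0 dE] := complex_gt0 (divr_gt0 (mulr_gt0 e0 b0) (ltr0Sn C 1)).
have /seq_cvgP/(_ d d0)[N hN] := succ_mul_expr_cvg0 t0 t1.
exists N => m /hN; rewrite subr0 ger0_norm ?mulr_ge0 ?exprn_ge0 // -ltcR -dE.
have -> : (m.+1%:R * t ^+ m)%:C%C = m.+1%:R * `|x| ^+ m.
  by rewrite xt -[RHS]/(_ * _) -rmorphXn -(rmorph_nat (real_complex R))
    -rmorphM.
rewrite ltr_pdivlMr // => hm.
rewrite -(ltr_pM2r b0) -{1}normrX -normrM; apply: le_lt_trans hm.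
rewrite mulrBl mulVf ?expf_neq0 // mulrC /series /= big_mkord sum_succ_mul_expr.
rewrite addrAC [1 - _]addrC addrK addrC; apply: le_trans (ler_normB _ _) _.
rewrite mulr_natr mulr2n lerD // !normrM !normr_nat !normrX //.
rewrite exprSr mulrA -[leRHS]mulr1 ler_pM ?mulr_ge0 ?exprn_ge0 // ?(ltW x1) //.
by rewrite ler_wpM2r ?exprn_ge0 // ler_nat.
Qed.

(** Recentring at z: 1 - bw = (1 - bz)(1 - rho (w - z)), followed by the square of the geometric
    series on a ball where |rho (w - z)| < 1. *)
Lemma analytic_at_inv_sqr (b z : C) : 1 - b * z != 0 ->
  analytic_at (C := C : numFieldType) (fun w => (1 - b * w) ^- 2) z.
Proof.
move=> bz; pose be := 1 - b * z; pose rho := b / be.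
exists (fun k => be ^- 2 * (k.+1%:R * rho ^+ k)).
have d0 : 0 < (`|rho| + 1)^-1 by rewrite invr_gt0 ltr_wpDl.
apply/near_ballP; exists (`|rho| + 1)^-1 => // w wz.
have hx : `|rho * (w - z)| < 1.
  rewrite normrM; apply: le_lt_trans (_ : _ <= (`|rho| + 1) * `|w - z|) _.
    by rewrite ler_wpM2r // lerDl.
  by rewrite mulrC -ltr_pdivlMr ?ltr_wpDl // mul1r.
have -> : (1 - b * w) ^- 2 = be ^- 2 * (1 - rho * (w - z)) ^- 2.
  rewrite -!exprVn -exprMn -invfM; congr (_^-1 ^+ 2).
  rewrite /rho mulrBr mulr1 mulrA [be * _]mulrC divfK // /be; ring.
rewrite (_ : series _ = (fun n => be ^- 2 *
    series (fun k => k.+1%:R * (rho * (w - z)) ^+ k) n)); last first.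
  apply/funext => n; rewrite /series /= big_distrr; apply: eq_bigr => k _ /=.
  by rewrite [(rho * _) ^+ k]exprMn -!mulrA.
by apply: cvgMr; exact: geometric_square_cvg.
Qed.

(** The points with a punctured neighbourhood on which the identity holds form an open set, closed
    by [meromorphic_dichotomy]: two incompatible alternatives cannot hold near a common point. *)
Lemma meromorphic_identity (f : C -> C) (p r : {poly C}) :
  meromorphic (C := C : numFieldType) f ->
  (\forall w \near (0 : (C : numFieldType)), f w * r.[w] = p.[w]) ->
  forall z, \forall w \near (z : (C : numFieldType))^', f w * r.[w] = p.[w].
Proof.
move=> f_mer f0 z; pose K : numFieldType := C.
pose A : set K := [set v : K | \forall w \near v^', f w * r.[w] = p.[w]].
have Aopen : open A.
  by rewrite openE => v /dnear_shift.
have Aclosed : closed A.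
  rewrite -openC openE => v /= vA.
  have [/vA //|/dnear_shift] := meromorphic_dichotomy p r v f_mer.
  apply: filterS => u hu uA; have [w [e]] : exists w : K, f w * r.[w] = p.[w]
    /\ f w * r.[w] != p.[w].
    by apply: (@filter_ex _ u^'); near=> w; split; near: w.
  by rewrite e eqxx.
(* Connectedness is used only along the real line through 0 and z: the preimage of A is clopen in R
   and contains 0, hence also 1. *)
pose line (t : R) : K := t%:C%C * z.
have line_cont : continuous line.
  move=> t; apply/cvgrPdist_lt => e /complex_gt0[d d0 ->].
  have zE := norm_complexE z; set y := complex.Re `|z| in zE.
  have y0 : 0 <= y by rewrite -lecR -zE; exact: normr_ge0.
  have y1 : 0 < y + 1 by rewrite ltr_wpDl.
  near=> s.
  rewrite /line -mulrBl -rmorphB normrM zE normc_def /= expr0n addr0 sqrtr_sqr.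
  rewrite -rmorphM ltcR (@le_lt_trans _ _ (`|t - s| * (y + 1))) //.
    by rewrite ler_wpM2l // lerDl.
  rewrite -ltr_pdivlMr //; near: s; apply/nbhs_normP;
    exists (d / (y + 1)) => //=.
  by rewrite divr_gt0.
have [Topen Tclosed] : clopen (line @^-1` A) by apply: preimage_clopen.
have /connected_intervalP Rconn : is_interval [set: R] by [].
have TE : line @^-1` A = setT.
  apply: Rconn.
  - exists 0; rewrite /= /A /line /= mul0r; apply: nbhs_dnbhs; exact: f0.
  - by exists (line @^-1` A) => //; rewrite setTI.
  - by exists (line @^-1` A) => //; rewrite setTI.
have : (line @^-1` A) 1 by rewrite TE.
by rewrite /A /line /= mul1r.
Unshelve. all: by end_near. Qed.


End ComplexSeries.

(** * Unordered sums over monic polynomials *)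

Section UnorderedSums.

Variables (F : finFieldType) (C : numFieldType).

(** Turns a sum over an arbitrary finite set into one over a finite type, where reindexing and
    splitting by size are available. *)
Lemma partial_sum_npoly (x : {poly F} -> C) (A : {fset {poly F}}) (m : nat) :
  (forall f, f \in A -> (size f <= m)%N) ->
  partial_sum x A = \sum_(a : {poly_m F} | polyn a \in A) x (polyn a).
Proof.
move=> Am; rewrite /partial_sum -(big_seq_fsetE _ _ xpredT) /=.
rewrite -[RHS]big_filter -[RHS](big_map (@polyn F m) xpredT x).
apply: perm_big; apply: uniq_perm; first exact: fset_uniq.
  rewrite map_inj_uniq ?filter_uniq ?index_enum_uniq //; exact: val_inj.
move=> f; apply/idP/mapP => [fA|[a]]; last by rewrite mem_filter => /andP[aA _]
  ->.
exists (npolyp m f); last by rewrite npolypK // Am.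
by rewrite mem_filter mem_index_enum andbT npolypK // Am.
Qed.

Definition fset_npoly (m : nat) : {fset {poly F}} :=
  [fset polyn a | a in {: {poly_m F}}]%fset.

Lemma in_fset_npoly m f : (f \in fset_npoly m) = (size f <= m)%N.
Proof.
apply/imfsetP/idP => [[a _ ->]|fm]; first exact: size_npoly.
by exists (npolyp m f); rewrite ?inE // npolypK.
Qed.

Lemma size_bounded_fset (A : {fset {poly F}}) :
  exists M, forall f, f \in A -> (size f <= M)%N.
Proof.
exists (\max_(f <- A) size (f : {poly F})) => f fA.
by apply: leq_bigmax_seq.
Qed.

(* Outside the polynomials of size at most [m], a partial sum is bounded by a
   tail of the sum of norms. *)
Lemma sums_to_monic (x : {poly F} -> C) (N : nat -> C) (s L : C) :
  (forall f, f \isn't monic -> x f = 0) ->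
  (forall k, \sum_(r : {poly_k F}) `|x ('X^k + polyn r)| = N k) ->
  (series N @ \oo --> L)%classic ->
  ((fun m => \sum_(k < m) \sum_(r : {poly_k F}) x ('X^k + polyn r)) @ \oo -->
    s)%classic ->
  sums_to x s.
Proof.
move=> x0 xN NL xs; rewrite /sums_to.
have sumE (y : {poly F} -> C) m : (forall f, f \isn't monic -> y f = 0) ->
    \sum_(a : {poly_m F}) y (polyn a) =
    \sum_(k < m) \sum_(r : {poly_k F}) y ('X^k + polyn r).
  move=> y0; rewrite -big_monic [RHS]big_mkcond; apply: eq_bigr => a _.
  by case: ifP => // /negbT/y0.
have N0 k : 0 <= N k by rewrite -xN sumr_ge0.
have N_le m M : (m <= M)%N -> series N m <= series N M.
  move=> mM; rewrite /series /= (@big_cat_nat _ _ _ m 0 M) //= lerDl.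
  by apply: sumr_ge0.
have tot_filter : ProperFilter (@totally {poly F}) by exact: totally_filter.
apply/cvgrPdist_lt => e e0.
have e2 : 0 < e / 2 by rewrite divr_gt0.
(* Tolerance e/4 for the norm series, whose tail costs two such errors, and e/2 for the partial sums
   of [x]. *)
move/seq_cvgP: NL => /(_ _ (divr_gt0 e2 (ltr0Sn C 1)))[m1 h1].
move/seq_cvgP: xs => /(_ _ e2)[m2 h2].
pose m := maxn m1 m2.
exists (fset_npoly m) => // A /fsubsetP mA /=.
have [M0 AM0] := size_bounded_fset A; pose M := maxn m M0.
have mM : (m <= M)%N by rewrite leq_maxl.
have AM f : f \in A -> (size f <= M)%N.
  by move=> /AM0 /leq_trans; apply; rewrite leq_maxr.
have smE : \sum_(k < m) \sum_(r : {poly_k F}) x ('X^k + polyn r) =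
    \sum_(a : {poly_M F} | (size (polyn a) <= m)%N) x (polyn a).
  rewrite -sumE //; transitivity (partial_sum x (fset_npoly m)).
    rewrite (@partial_sum_npoly _ _ m) => [|f]; last by rewrite in_fset_npoly.
    by apply: eq_bigl => a; rewrite in_fset_npoly size_npoly.
  rewrite (@partial_sum_npoly _ _ M) => [|f]; last first.
    by rewrite in_fset_npoly => /leq_trans; apply.
  by apply: eq_bigl => a; rewrite in_fset_npoly.
have nmE (k : nat) : (k <= M)%N -> series N k =
    \sum_(a : {poly_M F} | (size (polyn a) <= k)%N) `|x (polyn a)|.
  move=> kM; rewrite /series /= big_mkord.
  under eq_bigr => i _ do rewrite -xN.
  rewrite -(sumE (fun f => `|x f|)) => [|f /x0->]; last by rewrite normr0.
  transitivity (partial_sum (fun f => `|x f|) (fset_npoly k)).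
    rewrite (@partial_sum_npoly _ _ k) => [|f]; last by rewrite in_fset_npoly.
    by apply: eq_bigl => a; rewrite in_fset_npoly size_npoly.
  rewrite (@partial_sum_npoly _ _ M) => [|f]; last first.
    by rewrite in_fset_npoly => /leq_trans; apply.
  by apply: eq_bigl => a; rewrite in_fset_npoly.
rewrite distrC; set S := \sum_(k < m) _ in smE.
apply: le_lt_trans (ler_distD S _ _) _.
rewrite [e](splitr e) ltrD //; last by apply: h2; rewrite leq_maxr.
have tail : `|partial_sum x A - S| <= series N M - series N m.
  rewrite (partial_sum_npoly _ AM) smE.
  rewrite (bigID (fun a : {poly_M F} => (size (polyn a) <= m)%N)) /=.
  rewrite (eq_bigl (fun a : {poly_M F} => (size (polyn a) <= m)%N)); last first.
    move=> a; case: leqP => am; rewrite ?andbF ?andbT //.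
    by apply: mA; rewrite in_fset_npoly.
  rewrite addrAC subrr add0r (nmE M) // (nmE m) //.
  rewrite [X in _ <= X - _](bigID (fun a : {poly_M F} => (size (polyn a) <=
    m)%N)) /=.
  rewrite [X in _ <= X + _ - _](eq_bigl (fun a : {poly_M F} => (size (polyn a)
    <= m)%N)); last first.
    by move=> a; rewrite size_npoly.
  rewrite addrAC subrr add0r; apply: le_trans (ler_norm_sum _ _ _) _.
  rewrite big_mkcond [leRHS]big_mkcond; apply: ler_sum => a _.
  by rewrite size_npoly /=; case: (_ \in A); case: leqP => //= _;
    rewrite ?normr_ge0.
apply: le_lt_trans tail _.
rewrite -[_ - _]ger0_norm ?subr_ge0 ?N_le //.
apply: le_lt_trans (ler_distD L _ _) _; rewrite [e / 2](splitr (e / 2)) ltrD //.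
  by apply: h1; rewrite (leq_trans _ mM) // leq_maxl.
by rewrite distrC h1 // leq_maxl.
Qed.

End UnorderedSums.

(** * The Estermann function *)

Section EstermannFunction.

Local Open Scope classical_set_scope.

Variables (R : realType) (F : finFieldType) (g : {poly F}) (n : nat).
Hypotheses (g_monic : g \is monic) (size_g : size g = n.+1) (n_gt0 : (0 < n)%N).
Variable c : {poly F}.
Hypothesis c_g : coprimep c g.

Local Notation C := (R[i] : numFieldType).
Local Notation q := (#|F|%:R : R[i]).
Local Notation D := (estermann_rat g n c : R[i] -> R[i]).

Let q0 : q != 0 := card_field_complex_neq0 R F.
Let q_gt0 : 0 < q. Proof. by rewrite lt0r q0 ler0n. Qed.

(** The norms sum to (1 - q|u|)^-2. The partial sums by degree are, from 2n terms on, P_c(u) plus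
    q^n u^(2n) times those of (1 - qu)^-2. *)
Lemma estermann_rat_sums_to (u : R[i]) : `|u| < q^-1 ->
  sums_to (C := C) (estermann_term c g u) (D u).
Proof.
move=> uq; have qu : `|q * u| < 1.
  by rewrite normrM normr_nat mulrC -ltr_pdivlMr // mul1r.
have nqu : `|q * `|u| | < 1 by rewrite normrM normr_id -normrM.
apply: (sums_to_monic (N := fun k => k.+1%:R * (q * `|u|) ^+ k)).
- by move=> f; rewrite /estermann_term => /negbTE->.
- by move=> k; exact: sum_norm_estermann_term.
- exact: geometric_square_cvg nqu.
suff h : (fun m => \sum_(k < m + n * 2)
    \sum_(r : {poly_k F}) estermann_term c g u ('X^k + polyn r)) @ \oo --> (D u
      : C).
  by rewrite -(cvg_shiftn (n * 2)); exact: h.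
rewrite (_ : (fun _ => _) = (fun m => estermann_fin g n c u + q ^+ n * u ^+ (n
  * 2) *
    series (fun k => k.+1%:R * (q * u) ^+ k) m)); last first.
  apply/funext => m; rewrite addnC (sum_estermann_terms g_monic size_g n_gt0
    c_g).
  by rewrite /series /= big_mkord.
apply: (@cvgD C C); first exact: cvg_cst.
by apply: cvgMr; exact: geometric_square_cvg.
Qed.

(** P_c as a formal polynomial, so that analyticity and the identity principle for rational
    functions apply to it. *)
Definition estermann_poly : {poly R[i]} :=
  \sum_(i < n) \sum_(j < n) psi_sum R g c i j *: 'X^(i + j).

Lemma horner_estermann_poly u : estermann_poly.[u] = estermann_fin g n c u.
Proof.
rewrite (estermann_finE g n c) horner_sum; apply: eq_bigr => i _.
rewrite horner_sum; apply: eq_bigr => j _.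
by rewrite hornerZ hornerXn mulrC.
Qed.

Lemma analytic_estermann_rat z : 1 - q * z != 0 -> analytic_at (C := C) D z.
Proof.
move=> qz.
have -> : D = (fun w => estermann_poly.[w] +
    (1 - q * w) ^- 2 * (q ^+ n *: 'X^(n * 2)).[w]).
  by apply/funext => w; rewrite horner_estermann_poly hornerZ hornerXn mulrC.
apply: (analytic_at_add (C := C)); first exact: (analytic_at_horner0 (C := C)).
by apply: (analytic_at_horner (C := C)); exact: analytic_at_inv_sqr.
Qed.

Lemma meromorphic_estermann_rat : meromorphic (C := C) D.
Proof.
move=> z; have [qz|] := eqVneq (1 - q * z) 0; last by left;
  exact: analytic_estermann_rat.
have zE : z = q^-1.
  by apply: (mulfI q0); rewrite divff //; apply/esym/eqP; rewrite -subr_eq0 qz.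
(* As 1 - qw = -q(w - z), h is D(w) (w - z)^2 off z, and its value at z = 1/q is q^-2 q^n q^(-2n),
   which is nonzero. *)
right; exists 2%N; pose h : {poly R[i]} := q ^- 2 *:
  (estermann_poly * (1 - q *: 'X) ^+ 2 + q ^+ n *: 'X^(n * 2)).
have hE w : h.[w] = q ^- 2 * (estermann_fin g n c w * (1 - q * w) ^+ 2 +
    q ^+ n * w ^+ (n * 2)).
  rewrite /h hornerZ hornerD [X in X + _]hornerM horner_estermann_poly.
  by rewrite hornerZ hornerXn horner_exp !hornerE.
exists (fun w => h.[w]); split=> //; first exact: analytic_at_horner0.
  rewrite hE qz expr0n mulr0 add0r !mulf_neq0 ?invr_eq0 ?expf_neq0 //.
  by rewrite zE invr_eq0.
near=> w; have wz : w - z != 0 by rewrite subr_eq0; near: w; exact: dnear_neq.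
rewrite hE /estermann_rat.
have -> : 1 - q * w = - q * (w - z) by rewrite zE mulNr mulrBr divff // opprB.
by field; apply/andP.
Unshelve. all: by end_near. Qed.

Lemma is_estermann_rat : is_estermann c g D.
Proof.
by split; [exact: meromorphic_estermann_rat | exact: estermann_rat_sums_to].
Qed.

Lemma estermannP : is_estermann c g (estermann R c g).
Proof. by apply: xgetPex; exists D; exact: is_estermann_rat. Qed.

(** The chosen continuation and D are sums of the same series for |u| < 1/q. The identity principle,
    applied after multiplication by (1 - qu)^2, extends the agreement to punctured neighbourhoods of
    every point, and [meromorphic_eq_at] recovers the value at z. *)
Lemma estermann_ratE z : 1 - q * z != 0 -> estermann R c g z = D z.
Proof.
have [e_mer e_sum] := estermannP.
pose r : {poly R[i]} := (1 - q *: 'X) ^+ 2.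
pose p := estermann_poly * r + q ^+ n *: 'X^(n * 2).
have rE w : r.[w] = (1 - q * w) ^+ 2 by rewrite /r horner_exp !hornerE.
have DE w : 1 - q * w != 0 -> D w * r.[w] = p.[w].
  move=> qw; rewrite /p hornerD [(_ * r).[w]]hornerM hornerZ hornerXn.
  rewrite horner_estermann_poly rE.
  by rewrite mulrDl divfK // expf_neq0.
have qV : 0 < q^-1 by rewrite invr_gt0.
have e0 : \forall w \near (0 : C), estermann R c g w * r.[w] = p.[w].
  apply/near_ballP; exists q^-1 => // w; rewrite subr0 => wq.
  have tot_filter : ProperFilter (@totally {poly F}) by exact: totally_filter.
  have -> : estermann R c g w = D w.
    apply: (@cvg_unique C _ _ _ _ _ (e_sum w wq) (estermann_rat_sums_to wq)).
    exact: norm_hausdorff.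
  apply: DE; rewrite subr_eq0; apply: contraTneq wq => /(congr1 Num.norm).
  rewrite normr1 normrM normr_nat => qw.
  have -> : `|w| = q^-1 by apply: (mulfI q0); rewrite -qw divff.
  by rewrite ltxx.
move=> qz; apply: (meromorphic_eq_at e_mer (analytic_estermann_rat qz)).
have ez := meromorphic_identity e_mer e0 z.
near=> w.
have qw : 1 - q * w != 0.
  have : w != q^-1 by near: w; exact: dnear_neq.
  by apply: contra_neq => /subr0_eq qw; apply: (mulfI q0); rewrite -qw divff.
have r0 : r.[w] != 0 by rewrite rE expf_neq0.
by apply: (mulIf r0); rewrite DE //; near: w.
Unshelve. all: by end_near. Qed.

End EstermannFunction.

(** * The functional equation of the Estermann function *)

Theorem proposition3p7 (R : realType) (F : finFieldType)
    (g c cbar : {poly F})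
    (g_monic : g \is monic) (g_deg : (1 <= (size g).-1)%N)
    (c_g : coprimep c g) (cbarP : g %| c * cbar - 1) :
  let q : R[i] := #|F|%:R in
  [/\ is_estermann c g (estermann R c g),
      eq_meromorphic (estermann R c g)
        (fun u : R[i] =>
           (q * u ^+ 2) ^+ ((size g).-1 - 1) *
           \sum_(l : F | l != 0)
             calA l u * estermann R (l *: cbar) g (1 / (q * u))) &
      forall (l : F) (u : R[i]), l != 0 -> 1 - q * u != 0 ->
        calA l u =
          Kl2 R (-1) l / q + (1 + q - 2 * q * u) / (q * (1 - q * u) ^+ 2)].
Proof.
move=> q; have size_g : size g = (size g).-1.+1 by move: g_deg; case: (size g).
have q0 : q != 0 := card_field_complex_neq0 R F.
(* The divisibility hypothesis is a Bezout relation between g and cbar, so the dual Estermann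
   functions are also given by [estermann_ratE]. *)
have cbar_g (l : F) : l != 0 -> coprimep (l *: cbar) g.
  move=> l0; rewrite coprimepZl // coprimep_sym.
  have /dvdpP[k kE] := cbarP; apply/Bezout_eq1_coprimepP; exists (- k, c) => /=.
  by rewrite mulNr -kE opprB subrK.
split; first exact: (estermannP R g_monic size_g g_deg c_g).
  move=> z; near=> u.
  (* A punctured neighbourhood can avoid 0, where 1/(qu) is a default value, 1, where 1/(qu) is the
     pole 1/q, and 1/q itself. *)
  have u0 : u != 0 by near: u; exact: dnear_neq.
  have u1 : u != 1 by near: u; exact: dnear_neq.
  have qu : 1 - q * u != 0.
    have : u != q^-1 by near: u; exact: dnear_neq.
    by apply: contra_neq => /subr0_eq qu; apply: (mulfI q0); rewrite -qu divff.
  rewrite (estermann_ratE g_monic size_g g_deg c_g qu).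
  rewrite (estermann_rat_eq g_monic size_g g_deg cbarP u0 qu u1) subn1.
  congr (_ * _); apply: eq_bigr => l l0; congr (_ * _).
  rewrite (estermann_ratE g_monic size_g g_deg (cbar_g l l0)) //.
  have -> : 1 - q * (1 / (q * u)) = (u - 1) / u by field; rewrite u0.
  by rewrite mulf_neq0 ?invr_eq0 // subr_eq0.
exact: calA_closed_form.
Unshelve. all: by end_near. Qed.
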